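(* Let $a, b, n$ and $k$ be positive integers with $1\le k\le n$, and let $$S_{a,b}(n,k):=\sum_{0\le i_1<\cdots<i_k\le n-1}\prod_{j=1}^k\frac{1}{ai_j+b}.$$ Then $S_{a,b}(n,k)$ is not an integer, except in the following cases, in which $S_{a,b}(n,k)$ is an integer: either $b=n=k=1$ (with $a\ge 1$ arbitrary), or $a=b=1$, $n=3$ and $k=2$.
   Context: $S_{a,b}(n,k)$ is the $k$-th elementary symmetric function of the numbers $1/b, 1/(a+b), \dots, 1/(a(n-1)+b)$. *)

(* Defs.v *)
From mathcomp Require Import all_boot all_order all_algebra.

Set Implicit Arguments.
Unset Strict Implicit.
Unset Printing Implicit Defensive.

Import GRing.Theory Num.Theory.

Local Open Scope ring_scope.

(* The sum ranges over the k-tuples i_1 < ... < i_k of elements of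
   {0, ..., n - 1}; the j-th entry is tnth i j, with j numbered from 0. *)
Definition Sab (a b n k : nat) : rat :=
  \sum_(i : k.-tuple 'I_n | sorted ltn (map val i))
     \prod_(j < k) (1 / (a * tnth i j + b)%N%:R).

(* Main.v *)
From Stdlib Require Import NArith.
Require Import Defs.
From mathcomp Require Import all_boot all_order all_algebra.
From mathcomp Require Import zify ring lra.

(* Write t_i = a i + b, i < n, and F_k for the coefficient of X^k in
   \prod_i (t_i + X), so that S_{a,b}(n, k) = F_k / F_0.

   If p is a prime not dividing a and at least k of the t_i are divisible by p,
   then these are p c, p (c + a), ..., p (c + (m - 1) a), and comparing p-adic
   valuations, integrality of S forces p to divide the coefficient of X^k in
   \prod_(j < m) (c + a j + X).  This is absurd for m = k, and also for m = k + 1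
   when p is not too small: so a prime in ]n / (k + 1), n / k] is enough.

   Integrality also gives S >= 1, which bounds a k and k by O(log n) and
   b by O(n / k).

   For n >= 2^27, every prime in ]x, 2 x], x = n / (2 k), divides one of at most
   k (a + 5) explicit coefficients, whose product is exp(polylog n), while by
   Chebyshev's estimate the product of these primes exceeds 4^(x / 3) up to a
   factor exp(O(sqrt x log x)).

   For n < 2^27, k <= 61 and a chain of 460 primes whose ratios are close to 1
   covers nearly all pairs (n, k).  The remaining ones, all with n < 7000, leave some
   50000 admissible quadruples, each refuted by a prime as above or by an
   integer M that divides F_0 but not F_k. *)

Set Implicit Arguments.
Unset Strict Implicit.
Unset Printing Implicit Defensive.

(** * Coefficients and size bounds *)

Section Coefficients.

Import Order.TTheory GRing.Theory Num.Theory.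
Local Open Scope ring_scope.


(* Coefficient of X^r in \prod_(x <- s) (x + X). *)
Fixpoint fc (s : seq nat) (r : nat) : nat :=
  if s is x :: s' then (x * fc s' r + (if r is r'.+1 then fc s' r' else 0))%N
  else (r == 0)%N.

Definition ap (a b n : nat) : seq nat := [seq (a * i + b)%N | i <- iota 0 n].

Lemma size_ap a b n : size (ap a b n) = n.
Proof. by rewrite size_map size_iota. Qed.

Lemma fc0 s : fc s 0 = \prod_(x <- s) x :> nat.
Proof.
elim: s => [|x s IHs] /=; first by rewrite big_nil.
by rewrite big_cons addn0 IHs.
Qed.

Lemma fc_gt0 s : all (leq 1) s -> (0 < fc s 0)%N.
Proof. by elim: s => //= x s IHs /andP[x0 /IHs]; rewrite addn0 muln_gt0 x0. Qed.

Lemma ap_gt0 a b n : (0 < b)%N -> all (leq 1) (ap a b n).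
Proof. by move=> b0; apply/allP => x /mapP[i _ ->]; rewrite addn_gt0 b0 orbT. Qed.

Lemma fc_over s r : (size s < r)%N -> fc s r = 0%N.
Proof.
elim: s r => [|x s IHs] [|r] //= sr; rewrite IHs ?IHs ?muln0 //.
by apply: ltnW.
Qed.

Lemma fc_size s : fc s (size s) = 1%N.
Proof. by elim: s => //= x s ->; rewrite fc_over // muln0. Qed.

Lemma coef_fc (s : seq nat) r :
  (\prod_(x <- s) (x%:R%:P + 'X) : {poly rat})`_r = (fc s r)%:R.
Proof.
elim: s r => [|x s IHs] r /=; first by rewrite big_nil coef1; case: r.
rewrite big_cons mulrDl coefD coefCM coefXM !IHs natrD natrM.
by case: r => [|r] //=; rewrite IHs.
Qed.

(** When the product is expanded over subsets J, the coefficient of X^k collects the J of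
    cardinality k; [enum J] matches these with the increasing k-tuples. *)
Lemma sum_sorted_tuples n k (x : 'I_n -> rat) :
  \sum_(i : k.-tuple 'I_n | sorted ltn (map val i)) \prod_(j < k) x (tnth i j) =
  (\prod_(i < n) (1 + x i *: 'X) : {poly rat})`_k.
Proof.
have -> : \prod_(i < n) (1 + x i *: 'X) =
    \sum_(J : {set 'I_n}) (\prod_(i in J) x i) *: 'X^#|J| :> {poly rat}.
  under eq_bigr do rewrite addrC.
  rewrite bigA_distr; apply: eq_bigr => J _.
  rewrite (bigID (mem J)) /= [X in _ * X]big1 ?mulr1; last by move=> i /negPf->.
  rewrite (eq_bigr (fun i => (x i)%:P * 'X)); last by move=> i ->; rewrite mul_polyC.
  by rewrite big_split /= prodr_const -rmorph_prod /= mul_polyC.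
rewrite coef_sum.
rewrite (eq_bigr (fun J : {set _} => \prod_(i in J) x i * (k == #|J|)%:R)); last first.
  by move=> J _; rewrite coefZ coefXn.
rewrite (bigID (fun J : {set 'I_n} => #|J| == k)) /= [X in _ + X]big1 ?addr0; last first.
  by move=> J /negPf; rewrite eq_sym => ->; rewrite mulr0.
rewrite (eq_bigr (fun J : {set 'I_n} => \prod_(i in J) x i)); last first.
  by move=> J /eqP->; rewrite eqxx mulr1.
case: (posnP k) => [k0|k0].
  subst k; rewrite (big_pred1 [tuple]); last first.
    by move=> t; rewrite (tuple0 t); apply/esym/eqP.
  rewrite (big_pred1 set0); last by move=> J; rewrite cards_eq0.
  by rewrite big_ord0 big_set0.
have [n0|n0] := posnP n.
  subst n; rewrite !big1 //.
    move=> J /eqP Jk; have := max_card (mem J); rewrite Jk card_ord leqNgt k0 //.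
  by move=> t; case: (tnth t (Ordinal k0)).
(* [insubd] takes this default only on sets of the wrong cardinality. Building it requires an
   element of ['I_n], whence the separate case n = 0. *)
pose dflt : k.-tuple 'I_n := [tuple Ordinal n0 | i < k].
have valE (J : {set 'I_n}) : #|J| = k -> tval (insubd dflt (enum J)) = enum J.
  by move=> Jk; rewrite -[tval _]/(val _) val_insubd -cardE Jk eqxx.
rewrite (reindex_onto (fun t : k.-tuple 'I_n => [set i in t])
  (fun J : {set 'I_n} => insubd dflt (enum J))) /=; last first.
  move=> J /eqP /valE Jk; apply/setP => i; rewrite inE.
  by rewrite -[_ \in _]/(i \in tval _) Jk mem_enum.
have srt (J : {set 'I_n}) : sorted ltn (map val (enum J)).
  have -> : enum J = [seq i <- enum 'I_n | i \in J] by rewrite [enum 'I_n]enumT.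
  rewrite sorted_map; apply: (sorted_filter (leT := relpre val ltn)).
    by move=> ? ? ?; apply: ltn_trans.
  by rewrite -sorted_map val_enum_ord iota_ltn_sorted.
apply: eq_big => [t|t st].
  apply/idP/andP => [st|[/eqP tk /eqP <-]]; last first.
    by rewrite valE ?srt.
  have ut : uniq t by rewrite -(map_inj_uniq val_inj) (sorted_uniq ltn_trans ltnn).
  have tk : #|[set i in t]| = k by rewrite cardsE (card_uniqP ut) size_tuple.
  split; first by rewrite tk.
  apply/eqP/val_inj; rewrite /= valE //.
  apply: (inj_map val_inj); apply: (irr_sorted_eq ltn_trans ltnn) => //.
  move=> i; apply/mapP/mapP => -[j jt ->]; exists j => //.
    by move: jt; rewrite mem_enum inE.
  by rewrite mem_enum inE.
have ut : uniq t by rewrite -(map_inj_uniq val_inj) (sorted_uniq ltn_trans ltnn).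
rewrite (eq_bigl (mem t)); last by move=> i; rewrite inE.
by rewrite -big_uniq // big_tuple.
Qed.

Lemma Sab_fc a b n k : (0 < b)%N ->
  Sab a b n k * (fc (ap a b n) 0)%:R = (fc (ap a b n) k)%:R.
Proof.
move=> b0; rewrite /Sab.
rewrite (sum_sorted_tuples k (fun i : 'I_n => 1 / (a * i + b)%N%:R)).
rewrite -[RHS]coef_fc fc0 natr_prod.
have E : iota 0 n = index_iota 0 n by rewrite /index_iota subn0.
rewrite !big_map E !big_mkord.
rewrite mulrC -coefZ -mul_polyC rmorph_prod -big_split /=.
apply: (congr1 (fun q : {poly rat} => q`_k)); apply: eq_bigr => i _.
rewrite mulrDr mulr1 -mul_polyC mulrA -rmorphM /= mul1r mulfV ?mul1r //.
by rewrite pnatr_eq0; lia.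
Qed.

Lemma Sab_int a b n k : (0 < b)%N -> Sab a b n k \is a Num.int ->
  (fc (ap a b n) 0 %| fc (ap a b n) k)%N.
Proof.
move=> b0 /intrP[z Sz]; have := Sab_fc a n k b0; rewrite Sz => /eqP.
set f0 := fc _ 0; set fk := fc _ k => zf.
have {}zf : z * f0%:Z = fk%:Z.
  by apply/eqP; rewrite -(eqr_int rat) rmorphM /= -!pmulrn.
apply/dvdnP; exists `|z|%N; have := congr1 absz zf.
by rewrite abszM /= => ->.
Qed.

(** As p does not divide a, the indices i with p dividing a i + b form one class modulo p. Its first
    member is i0, with quotient c, and the two inequalities say that exactly m members lie below
    n. *)
Lemma filter_ap a b n p c i0 m : prime p -> ~~ (p %| a)%N ->
  (a * i0 + b = c * p)%N -> (i0 < p)%N ->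
  (n <= i0 + p * m)%N -> (i0 + p * m < n + p)%N ->
  [seq x <- ap a b n | p %| x]%N = [seq (p * x)%N | x <- ap a c m].
Proof.
move=> pp pa e0 i0p nm mn.
have -> : [seq (p * x)%N | x <- ap a c m] =
    [seq (a * i + b)%N | i <- [seq (i0 + p * j)%N | j <- iota 0 m]].
  by rewrite -!map_comp; apply: eq_map => j /=; nia.
rewrite filter_map; congr map.
apply: (irr_sorted_eq ltn_trans ltnn).
- by apply: sorted_filter; [exact: ltn_trans | exact: iota_ltn_sorted].
- rewrite sorted_map; apply: sub_sorted (iota_ltn_sorted 0 m) => x y /= xy.
  by rewrite ltn_add2l ltn_pmul2l ?prime_gt0.
move=> i; rewrite mem_filter mem_iota /= add0n; apply/andP/mapP => [[pi ilt]|[j]]; last first.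
  rewrite mem_iota add0n => /= jm ->; split.
    have -> : (a * (i0 + p * j) + b = p * (c + a * j))%N by nia.
    exact: dvdn_mulr.
  have : (p * j + p <= p * m)%N by rewrite addnC -mulnS leq_pmul2l ?prime_gt0.
  by lia.
have i0i : (i0 <= i)%N.
  rewrite leqNgt; apply/negP => ii0.
  have : (p %| i0 - i)%N.
    rewrite -(Gauss_dvdr _ (m := p) (n := a)) ?prime_coprime // mulnBr.
    have -> : (a * i0 - a * i = c * p - (a * i + b))%N by rewrite -e0; lia.
    by rewrite dvdn_sub ?dvdn_mull.
  by move/dvdn_leq; lia.
have : (p %| i - i0)%N.
  rewrite -(Gauss_dvdr _ (m := p) (n := a)) ?prime_coprime // mulnBr.
  have -> : (a * i - a * i0 = (a * i + b) - c * p)%N by rewrite -e0; lia.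
  by rewrite dvdn_sub ?dvdn_mull.
case/dvdnP => j ij; exists j; last by lia.
rewrite mem_iota /= add0n -(ltn_pmul2l (prime_gt0 pp)); lia.
Qed.

(* p-adic expansion of the coefficients: each of the m multiples of p in s
   contributes one factor p unless it is among the r factors giving X. *)
Lemma fc_padic p s g : [seq x <- s | p %| x]%N = [seq (p * x)%N | x <- g] ->
  forall r, (r <= size g)%N -> exists q, fc s r =
    (p ^ (size g - r) * (fc g r * \prod_(x <- s | ~~ (p %| x)%N) x + p * q))%N.
Proof.
elim: s g => [|x s IHs] [|c g] //=.
- by move=> _ r; rewrite leqn0 => /eqP->; exists 0%N; rewrite big_nil muln0.
- case: ifP => [//|/negbT px] sE r.
  have [q qE] := IHs [::] sE 0%N isT.
  rewrite leqn0 => /eqP-> /=; exists (x * q)%N.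
  by rewrite big_cons px qE /=; ring.
- case: ifP => [px|/negbT px] => [[xE gE]|/(IHs (c :: g)){}IHs] r rg.
    rewrite big_cons px /=; have := IHs g gE.
    set U := (\prod_(_ <- _ | _) _)%N => IH.
    have [rg'|rg'] := leqP r (size g); last first.
      have -> : r = (size g).+1 by lia.
      rewrite subnn (fc_over (ltnSn _)) muln0 add0n.
      have [q ->] := IH _ (leqnn _); rewrite subnn.
      by exists (c * fc s (size g).+1 + q)%N; rewrite xE; ring.
    have [q1 ->] := IH _ rg'; case: r rg rg' => [|r] rg rg'.
      by exists (c * q1)%N; rewrite subn0 xE expnS; ring.
    have [q2 ->] := IH _ (ltnW rg'); exists (c * q1 + q2)%N.
    have -> : (size g - r = (size g - r.+1).+1)%N by lia.
    have -> : ((size g).+1 - r.+1 = (size g - r.+1).+1)%N by lia.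
    by rewrite xE expnS; ring.
  rewrite big_cons px /=.
  have [q1 ->] := IHs _ rg; case: r rg => [|r] rg.
    by exists (x * q1)%N; rewrite subn0 /=; ring.
  have [q2 ->] := IHs _ (ltnW rg).
  set U := (\prod_(_ <- _ | _) _)%N; set h1 := fc (c :: g) r.+1; set h2 := fc (c :: g) r.
  exists (x * q1 + h2 * U + p * q2)%N.
  have -> : (size (c :: g) - r = (size (c :: g) - r.+1).+1)%N by move: rg => /=; lia.
  by rewrite -[(c * fc g r.+1 + fc g r)%N]/h1 -[(size g).+1]/(size (c :: g)) expnS; ring.
Qed.

(** With m = [size g], the expansion makes F_0 a multiple of p^m and F_k = p^(m - k) ([fc g k] U + p
    q), where p does not divide U. Cancelling p^(m - k) leaves p^k, hence p, dividing the
    bracket. *)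
Lemma dvdn_coef p s g k : prime p ->
  [seq x <- s | p %| x]%N = [seq (p * x)%N | x <- g] ->
  (0 < k <= size g)%N -> (fc s 0 %| fc s k)%N -> (p %| fc g k)%N.
Proof.
move=> pp sg /andP[k0 kg] dv.
have [q0 E0] := fc_padic sg (leq0n _); have [qk Ek] := fc_padic sg kg.
set U := (\prod_(_ <- _ | _) _)%N in E0 Ek.
have pU : ~~ (p %| U)%N.
  rewrite /U; elim/big_ind: _ => [|x y px py|x //].
    by rewrite dvdn1 neq_ltn prime_gt1 ?orbT.
  by rewrite Euclid_dvdM // negb_or px py.
move: dv; rewrite Ek E0 subn0.
have -> : (p ^ size g = p ^ (size g - k) * p ^ k)%N by rewrite -expnD subnK.
rewrite -mulnA dvdn_pmul2l ?expn_gt0 ?prime_gt0 // => dv.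
have : (p %| fc g k * U + p * qk)%N.
  apply: dvdn_trans dv; apply: dvdn_mulr; exact: dvdn_exp.
by rewrite (dvdn_addl _ (dvdn_mulr qk (dvdnn p))) Euclid_dvdM // (negPf pU) orbF.
Qed.


(** * Inequalities for coefficients, powers and factorials *)

Lemma fc_gt0_le s k : all (leq 1) s -> (k <= size s)%N -> (0 < fc s k)%N.
Proof.
elim: s k => [|x s IHs] [|k] //= /andP[x0 s0] ks.
  by rewrite addn0 muln_gt0 x0 IHs.
by rewrite addn_gt0 [X in _ || X]IHs // orbT.
Qed.

Lemma fc_eval s k r : (fc s k * r ^ k <= \prod_(x <- s) (x + r))%N.
Proof.
elim: s k => [|x s IHs] [|k] //=; rewrite ?big_nil ?big_cons //.
  by rewrite addn0 expn0 muln1 mulnDl; have := IHs 0%N; rewrite expn0 muln1; nia.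
by rewrite mulnDl mulnDl expnS; have := IHs k; have := IHs k.+1; rewrite expnS; nia.
Qed.

(** Evaluate the polynomial at X = a s: its term of degree k is at most its value, which is the
    product of the progression shifted by s places. That product differs from F_0 only by s factors
    at either end. *)
Lemma shift_bound a b n k s : (0 < b)%N -> (fc (ap a b n) 0 <= fc (ap a b n) k)%N ->
  ((a * s) ^ k * \prod_(0 <= j < s) (a * j + b) <= \prod_(0 <= j < s) (a * (n + j) + b))%N.
Proof.
move=> b0 F0k; have F0 := fc_gt0 (ap_gt0 a n b0).
have := fc_eval (ap a b n) k (a * s); rewrite big_map.
rewrite (_ : iota 0 n = index_iota 0 n); last by rewrite /index_iota subn0.
rewrite (eq_bigr (fun i => a * (i + s) + b)%N); last by move=> i _; nia.
have := big_addn 0 (n + s) s xpredT (fun i => a * i + b)%N (R := nat) (op := muln) (idx := 1%N).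
rewrite add0n addnK => <- ev.
have E : (\prod_(0 <= j < s) (a * j + b) * \prod_(s <= i < n + s) (a * i + b) =
   fc (ap a b n) 0 * \prod_(0 <= j < s) (a * (n + j) + b))%N.
  rewrite -big_cat_nat ?leq_addl //= fc0 big_map.
  rewrite (_ : iota 0 n = index_iota 0 n); last by rewrite /index_iota subn0.
  rewrite (@big_cat_nat _ _ _ n) ?leq_addr //=; congr (_ * _)%N.
  rewrite -{1}[n]add0n [(n + s)%N]addnC big_addn addnK.
  by apply: eq_bigr => i _; rewrite [(i + n)%N]addnC.
rewrite -(leq_pmul2l F0) -E mulnA [X in (X <= _)%N]mulnC leq_mul2l.
by rewrite (leq_trans _ ev) ?orbT // leq_mul2r F0k orbT.
Qed.

Lemma expnS_le3 k : (0 < k)%N -> (k.+1 ^ k <= 3 * k ^ k)%N.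
Proof.
move=> k0.
(* This is (1 + 1/k)^j <= 1 + j/k + (j/k)^2 with denominators cleared; j = k gives the constant
   3. *)
have H j : (j <= k)%N -> (k.+1 ^ j * k ^ 2 <= k ^ j * (k ^ 2 + j * k + j ^ 2))%N.
  elim: j => [|j IHj] jk; first by rewrite !expn0; lia.
  have {}IHj := IHj (ltnW jk).
  rewrite (expnS k.+1 j) (expnS k j) -mulnA; apply: leq_trans (_ : k.+1 * (k ^ j * (k ^ 2 + j * k + j ^ 2)) <= _)%N.
    by rewrite leq_mul2l IHj orbT.
  rewrite mulnCA -[X in (_ <= X)%N]mulnA [X in (_ <= X)%N]mulnCA leq_mul2l; apply/orP; right; nia.
have := H k (leqnn k).
rewrite (_ : k ^ 2 + k * k + k ^ 2 = 3 * k ^ 2)%N; last by lia.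
by rewrite mulnA leq_pmul2r ?expn_gt0 ?k0 // [(3 * _)%N]mulnC.
Qed.

(** A weak Stirling bound: from k to k + 1 the left side grows by at most 3 (k + 1), the right side
    by exactly that. The factor 4 is the one that arises in [tail_ge]. *)
Lemma pow_fact k : (1 < k)%N -> (4 * k ^ k < 3 ^ k * k`!)%N.
Proof.
elim: k => // k IHk; rewrite ltnS leq_eqVlt => /orP[/eqP<- //|k1].
have := IHk k1; have := expnS_le3 (ltnW k1); rewrite factS !expnS; nia.
Qed.

(** For positive entries this is the j-th elementary symmetric function of their reciprocals. *)
Definition esum_inv (s : seq nat) (j : nat) : rat := (fc s j)%:R / (fc s 0)%:R.

Lemma esum_inv0 s : all (leq 1) s -> esum_inv s 0 = 1.
Proof. by move=> /fc_gt0 s0; rewrite /esum_inv divff // pnatr_eq0 -lt0n. Qed.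

Lemma esum_inv_cons x s j : (0 < x)%N -> all (leq 1) s ->
  esum_inv (x :: s) j.+1 = esum_inv s j.+1 + x%:R^-1 * esum_inv s j.
Proof.
move=> x0 /fc_gt0 s0; rewrite /esum_inv /= addn0 natrD !natrM.
have xn : x%:R != 0 :> rat by rewrite pnatr_eq0 -lt0n.
have sn : (fc s 0)%:R != 0 :> rat by rewrite pnatr_eq0 -lt0n.
by field; apply/andP.
Qed.

Lemma esum_inv_ge0 s j : 0 <= esum_inv s j.
Proof. by rewrite divr_ge0 ?ler0n. Qed.

Lemma esum_inv1 s : all (leq 1) s -> esum_inv s 1 = \sum_(x <- s) x%:R^-1.
Proof.
elim: s => [|x s IHs] /=; first by rewrite big_nil /esum_inv /= mul0r.
by move=> /andP[x0 s0]; rewrite esum_inv_cons // esum_inv0 // IHs // mulr1 big_cons addrC.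
Qed.

(** In the j-th power of the sum of the reciprocals, every product of j distinct ones appears j!
    times. *)
Lemma esum_inv_fact s j : all (leq 1) s -> (j`!)%:R * esum_inv s j <= esum_inv s 1 ^+ j.
Proof.
elim: s j => [|x s IHs] [|j] s0; first by rewrite /esum_inv /= divff.
- by rewrite /esum_inv /= mul0r mulr0 exprn_ge0.
- by rewrite esum_inv0 // mulr1.
move: s0 => /= /andP[x0 s0].
rewrite !esum_inv_cons // esum_inv0 // mulr1.
set y := esum_inv s 1; set u := _^-1.
have y0 : 0 <= y := esum_inv_ge0 _ _.
have u0 : 0 <= u by rewrite invr_ge0 ler0n.
have h1 := IHs j.+1 s0; have h2 := IHs j s0.
(* The first two terms of the binomial expansion are enough for the induction on s. *)
have : y ^+ j.+1 + j.+1%:R * u * y ^+ j <= (y + u) ^+ j.+1.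
  elim: {h1 h2} j => [|j IHj]; first by rewrite !expr1 expr0; lra.
  rewrite [leRHS]exprS; apply: le_trans (_ : (y + u) * (y ^+ j.+1 + j.+1%:R * u * y ^+ j) <= _).
    have : 0 <= u * u * y ^+ j * j.+1%:R by rewrite !mulr_ge0 ?exprn_ge0 ?ler0n.
    rewrite !exprS -[j.+2]addn1 -[j.+1]addn1 !natrD; lra.
  by rewrite ler_wpM2l // addr_ge0.
apply: le_trans; rewrite mulrDr; apply: lerD => //.
rewrite factS natrM (_ : _ * _ * (u * _) = j.+1%:R * u * (j`!%:R * esum_inv s j)); last by ring.
by rewrite ler_wpM2l // mulr_ge0 ?ler0n.
Qed.

Lemma apS a b n : ap a b n.+1 = b :: ap a (a + b) n.
Proof.
rewrite /ap /= muln0 add0n; congr (_ :: _); rewrite -[in LHS](addn0 1%N) iotaDl -map_comp.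
by apply: eq_map => i /=; rewrite mulnDr muln1; lia.
Qed.

(** * Harmonic sums over dyadic blocks *)

Lemma sum_double (f : nat -> rat) m n : (m <= n)%N ->
  \sum_(2 * m <= i < 2 * n) f i = \sum_(m <= i < n) (f (2 * i)%N + f (2 * i).+1).
Proof.
elim: n => [|n IHn] mn; first by rewrite !big_geq //; lia.
have [->|mn'] := eqVneq m n.+1; first by rewrite !big_geq.
have {}mn : (m <= n)%N by lia.
rewrite [RHS]big_nat_recr //= -IHn // mulnS add2n.
by rewrite !big_nat_recr ?addrA //=; lia.
Qed.

(** Terms are paired by 1/(2 i) + 1/(2 i + 1) <= 1/i. *)
Lemma block_step L :
  \sum_(2 ^ L.+1 <= i < 2 ^ L.+2) i%:R^-1 <= \sum_(2 ^ L <= i < 2 ^ L.+1) i%:R^-1 :> rat.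
Proof.
rewrite (expnS 2 L) (expnS 2 L.+1) sum_double ?leq_pexp2l //.
rewrite -(expnS 2 L) big_nat_cond [leRHS]big_nat_cond.
apply: ler_sum => i /andP[/andP[i1 _] _].
have i0 : (0 < i)%N by apply: leq_trans i1; rewrite expn_gt0.
have -> : i%:R^-1 = (2 * i)%:R^-1 + (2 * i)%:R^-1 :> rat.
  by rewrite natrM; field; rewrite pnatr_eq0 -lt0n.
by rewrite lerD2l lef_pV2 ?posrE ?ltr0n ?muln_gt0 // ler_nat.
Qed.

(** Block sums decrease, and the block from 8 to 15 is already below 3/4. *)
Lemma dyadic_block L : \sum_(2 ^ L.+3 <= i < 2 ^ L.+4) i%:R^-1 <= 3 / 4 :> rat.
Proof.
apply: (@le_trans _ _ (\sum_(2 ^ 3 <= i < 2 ^ 4) i%:R^-1)); last first.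
  have -> : index_iota (2 ^ 3) (2 ^ 4) = [:: 8; 9; 10; 11; 12; 13; 14; 15]%N by [].
  by rewrite !big_cons big_nil; lra.
elim: L => [//|L IHL]; exact: le_trans (block_step _) IHL.
Qed.

(** The slope 15 is 20 times the bound 3/4 of a block; 22 is the least integer offset for which the
    direct checks with L <= 3 succeed. *)
Lemma harmonic_le L : 20 * \sum_(1 <= i < 2 ^ L.+1) i%:R^-1 <= (15 * L + 22)%:R :> rat.
Proof.
have base0 : 20 * \sum_(1 <= i < 2 ^ 1) i%:R^-1 <= (15 * 0 + 22)%:R :> rat.
  have -> : index_iota 1 (2 ^ 1) = [:: 1]%N by [].
  by rewrite !big_cons big_nil; lra.
have base1 : 20 * \sum_(1 <= i < 2 ^ 2) i%:R^-1 <= (15 * 1 + 22)%:R :> rat.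
  have -> : index_iota 1 (2 ^ 2) = [:: 1; 2; 3]%N by [].
  by rewrite !big_cons big_nil; lra.
have base2 : 20 * \sum_(1 <= i < 2 ^ 3) i%:R^-1 <= (15 * 2 + 22)%:R :> rat.
  have -> : index_iota 1 (2 ^ 3) = [:: 1; 2; 3; 4; 5; 6; 7]%N by [].
  by rewrite !big_cons big_nil; lra.
have base3 : 20 * \sum_(1 <= i < 2 ^ 4) i%:R^-1 <= (15 * 3 + 22)%:R :> rat.
  have -> : index_iota 1 (2 ^ 4) = [:: 1; 2; 3; 4; 5; 6; 7; 8; 9; 10; 11; 12; 13; 14; 15]%N by [].
  by rewrite !big_cons big_nil; lra.
have [L3|L3] := ltnP L 3.
  have [->|L0] := eqVneq L 0%N; first exact: base0.
  have [->|L1] := eqVneq L 1%N; first exact: base1.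
  have -> : L = 2%N by lia.
  exact: base2.
clear base0 base1 base2.
rewrite -(subnK L3); elim: (L - 3)%N => [|M IHM]; first exact: base3.
have -> : \sum_(1 <= i < 2 ^ (M + 3).+2) i%:R^-1 = \sum_(1 <= i < 2 ^ (M + 3).+1) i%:R^-1 +
    \sum_(2 ^ (M + 3).+1 <= i < 2 ^ (M + 3).+2) i%:R^-1 :> rat.
  by apply: big_cat_nat; rewrite ?expn_gt0 ?leq_exp2l.
have : \sum_(2 ^ (M + 3).+1 <= i < 2 ^ (M + 3).+2) i%:R^-1 <= 3 / 4 :> rat.
  by rewrite addn3; exact: (dyadic_block M.+1).
have -> : (15 * (M.+1 + 3) + 22 = 15 * (M + 3) + 22 + 15)%N by lia.
rewrite natrD; move: IHM; lra.
Qed.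

(** * Bounds on a, b and k from the size of the sum, for a progression of n + 1 terms *)

Section HarmonicTail.

Variables (a b n k : nat).
Hypotheses (b0 : (0 < b)%N) (n0 : (0 < n)%N) (k0 : (0 < k)%N) (kn : (k <= n.+1)%N).
Hypothesis F0k : (fc (ap a b n.+1) 0 %| fc (ap a b n.+1) k)%N.
(** The first term b is left out: the others, a i + b with i >= 1, are at least a i, so a y is at
    most the n-th harmonic number. *)
Let y : rat := \sum_(x <- ap a (a + b) n) x%:R^-1.

Let ab0 : all (leq 1) (ap a (a + b) n).
Proof. by apply: ap_gt0; rewrite addn_gt0 b0 orbT. Qed.

Let yE : y = esum_inv (ap a (a + b) n) 1. Proof. by rewrite esum_inv1. Qed.
Let y_ge0 : 0 <= y. Proof. by rewrite yE esum_inv_ge0. Qed.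

Lemma Sab_ge1 : 1 <= esum_inv (ap a b n.+1) k.
Proof.
have F0 := fc_gt0 (ap_gt0 a n.+1 b0).
rewrite ler_pdivlMr ?ltr0n // mul1r ler_nat dvdn_leq //.
by apply: fc_gt0_le; rewrite ?ap_gt0 // size_ap.
Qed.

(** The sum S >= 1 equals e_k + e_(k-1) / b, with e_j taken over the reciprocals after the first,
    and 1/b <= 1. Multiply by k! and use [esum_inv_fact] for both terms. *)
Lemma tail_fact : (1 < k)%N -> (k`!)%:R <= y ^+ k + k%:R * y ^+ k.-1.
Proof.
move=> k1; have := Sab_ge1; rewrite apS -(prednK k0) esum_inv_cons // prednK // => S1.
have h1 := esum_inv_fact k ab0; have h2 := esum_inv_fact k.-1 ab0.
have b1 : b%:R^-1 <= 1 :> rat by rewrite invf_le1 ?ltr0n // ler1n.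
have gk := esum_inv_ge0 (ap a (a + b) n) k.-1.
have S2 : 1 <= esum_inv (ap a (a + b) n) k + esum_inv (ap a (a + b) n) k.-1.
  apply: le_trans S1 _; rewrite lerD2l -[leRHS]mul1r; exact: ler_wpM2r.
rewrite yE; apply: le_trans (lerD h1 (ler_wpM2l (ler0n _ k) h2)).
have kf : (k * (k.-1)`! = k`!)%N by rewrite -{1}(prednK k0) -factS prednK.
rewrite [X in _ + X]mulrA -[X in _ + X * _]natrM kf -mulrDr.
by rewrite -[leLHS]mulr1 ler_wpM2l ?ler0n.
Qed.

(** If b >= 2, then 1/b <= 1/2 leaves at least 1/2 for y. If b = 1, then 1 + y is an integer greater
    than 1, so y >= 1. *)
Lemma tail_ge1 : k = 1%N -> 1 <= 2 * y.
Proof.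
move=> k1; have := Sab_ge1; rewrite k1 apS esum_inv_cons // esum_inv0 // mulr1 -yE => S1.
have [b1|b1] := leqP 2 b.
  suff : b%:R^-1 <= 2^-1 :> rat by lra.
  by rewrite lef_pV2 ?posrE ?ltr0n // (ler_nat _ 2).
have {b1} b1 : b = 1%N by lia.
case/dvdnP: F0k => q; rewrite k1 => Fq.
have yq : 1 + y = q%:R.
  have F0 := fc_gt0 (ap_gt0 a n.+1 b0).
  have : esum_inv (ap a b n.+1) 1 = q%:R by rewrite /esum_inv Fq natrM mulfK // pnatr_eq0 -lt0n.
  by rewrite apS esum_inv_cons // esum_inv0 // mulr1 -yE b1 invr1 addrC.
have y_gt0 : 0 < y.
  rewrite /y -(prednK n0) apS big_cons ltr_pwDl ?invr_gt0 ?ltr0n ?addn_gt0 ?b0 ?orbT //.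
  by apply: sumr_ge0 => x _; rewrite invr_ge0 ler0n.
suff : (2 <= q)%N by rewrite -(ler_nat rat) -yq; lra.
by rewrite -(ltr_nat rat) -yq; lra.
Qed.

(** Here y^2 + 2 y >= 2, and the positive root sqrt 3 - 1 exceeds 7/10. *)
Lemma tail_ge2 : k = 2%N -> 7 <= 10 * y.
Proof.
move=> k2; have := tail_fact; rewrite k2 /= expr1 expr2 => /(_ isT) y2.
have [//|y7] := lerP 7 (10 * y).
have y7' : 0 <= y * (7 - 10 * y) by apply: mulr_ge0; [exact: y_ge0 | rewrite subr_ge0 ltW].
rewrite (_ : (2`!)%:R = 2 :> rat) // in y2.
clear k2; lra.
Qed.

(** If 3 y < k, multiplying [tail_fact] by 3^k gives 3^k k! <= (3 y)^k + 3 k (3 y)^(k-1) <= 4 k^k,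
    against [pow_fact]. *)
Lemma tail_ge : k%:R <= 3 * y.
Proof.
have [k1|k1] := leqP k 1.
  have {}k1 : k = 1%N by lia.
  by have := tail_ge1 k1; rewrite k1; lra.
rewrite leNgt; apply/negP => yk; have := tail_fact k1; apply/negP; rewrite -ltNge.
have y3 : 3 * y <= k%:R by apply: ltW.
have h1 : (3 * y) ^+ k <= k%:R ^+ k by rewrite lerXn2r ?nnegrE ?mulr_ge0 ?ler0n.
have h2 : (3 * y) ^+ k.-1 <= k%:R ^+ k.-1 by rewrite lerXn2r ?nnegrE ?mulr_ge0 ?ler0n.
have h3 : k%:R * (3 * (3 * y) ^+ k.-1) <= 3 * k%:R ^+ k.
  have -> : k%:R ^+ k = k%:R * k%:R ^+ k.-1 :> rat by rewrite -exprS prednK.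
  by have := ler_wpM2l (ler0n rat k) h2; lra.
have := pow_fact k1; rewrite -(ltr_nat rat) !natrM !natrX => h4.
rewrite -(ltr_pM2l (_ : 0 < 3 ^+ k)) ?exprn_gt0 //; apply: le_lt_trans h4.
rewrite mulrDr -exprMn (_ : 3 ^+ k * (k%:R * y ^+ k.-1) = k%:R * (3 * (3 * y) ^+ k.-1)).
  by lra.
have -> : 3 ^+ k = 3 * 3 ^+ k.-1 :> rat by rewrite -exprS prednK.
by rewrite exprMn; ring.
Qed.

Let L := trunc_log 2 n.

Lemma tail_harmonic : 20 * (a%:R * y) <= (15 * L + 22)%:R.
Proof.
apply: le_trans (harmonic_le L); rewrite ler_pM2l // /y big_map mulr_sumr.
have nL : (n < 2 ^ L.+1)%N by apply: trunc_log_ltn.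
apply: (@le_trans _ _ (\sum_(1 <= i < n.+1) i%:R^-1)); last first.
  rewrite [leRHS](@big_cat_nat _ _ _ n.+1) //= lerDl.
  by apply: sumr_ge0 => i _; rewrite invr_ge0 ler0n.
rewrite big_add1 /= /index_iota subn0; apply: ler_sum => i _.
have t0 : 0 < (a * i + (a + b))%:R :> rat by rewrite ltr0n; lia.
rewrite ler_pdivrMr // mulrC ler_pdivlMr ?ltr0n // -natrM ler_nat; lia.
Qed.

Lemma tail_count : (a + b)%:R * y <= n%:R.
Proof.
rewrite /y big_map mulr_sumr -[n in leRHS](size_iota 0) -sum1_size natr_sum.
apply: ler_sum => i _; rewrite ler_pdivrMr ?ltr0n; last by lia.
by rewrite mul1r ler_nat; lia.
Qed.

Lemma bound_a : (20 * a * k <= 3 * (15 * L + 22))%N.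
Proof.
rewrite -(ler_nat rat); have := tail_harmonic; have := tail_ge => h1 h2.
have := ler_wpM2l (ler0n rat a) h1; rewrite !natrM; lra.
Qed.

Lemma bound_a1 : k = 1%N -> (10 * a <= 15 * L + 22)%N.
Proof.
move=> /tail_ge1 h1; rewrite -(ler_nat rat); have := tail_harmonic.
have := ler_wpM2l (ler0n rat a) h1; rewrite !natrM; lra.
Qed.

Lemma bound_a2 : k = 2%N -> (14 * a <= 15 * L + 22)%N.
Proof.
move=> /tail_ge2 h1; rewrite -(ler_nat rat); have := tail_harmonic.
have := ler_wpM2l (ler0n rat a) h1; rewrite !natrM; lra.
Qed.

Lemma bound_ab : (k * (a + b) <= 3 * n)%N.
Proof.
rewrite -(ler_nat rat); have := tail_count; have := tail_ge => h1 h2.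
have := ler_wpM2l (ler0n rat (a + b)) h1; rewrite !natrM; lra.
Qed.

Lemma bound_ab1 : k = 1%N -> (a + b <= 2 * n)%N.
Proof.
move=> /tail_ge1 h1; rewrite -(ler_nat rat); have := tail_count.
have := ler_wpM2l (ler0n rat (a + b)) h1; rewrite !natrM; lra.
Qed.

End HarmonicTail.

End Coefficients.

(** * Primes dividing the denominator *)

Lemma exists_multiple a b p : prime p -> ~~ (p %| a) -> exists2 i, i < p & p %| a * i + b.
Proof.
move=> pp pa; have p0 := prime_gt0 pp.
have a0 : 0 < a by case: a pa => //; rewrite dvdn0.
have cop : coprime a p by rewrite coprime_sym prime_coprime.
case: (egcdnP p a0) => u v; rewrite (eqP cop) => uv _.
(* The solution -b/a modulo p: u inverts a, and [p.-1] stands for -1. *)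
exists ((u * b * p.-1) %% p); first by rewrite ltn_pmod.
rewrite /dvdn -modnDml modnMmr modnDml.
have -> : a * (u * b * p.-1) + b = (v * b * p.-1 + b) * p.
  rewrite (_ : a * (u * b * p.-1) = u * a * (b * p.-1)); last by ring.
  by rewrite uv; move: (prednK p0); move: p.-1 => q <-; ring.
by rewrite modnMl.
Qed.

(** Here p c is the first multiple of p in the progression and m the number of multiples; k p <= n
    forces m >= k, and an index below p gives c p < a p + b. *)
Lemma window a b n k p : 0 < b -> prime p -> ~~ (p %| a) -> 0 < k -> k * p <= n ->
  fc (ap a b n) 0 %| fc (ap a b n) k ->
  exists c m, [/\ k <= m, m * p < n + p, 0 < c, c * p < a * p + b & p %| fc (ap a c m) k].
Proof.
move=> b0 pp pa k0 kpn F0k; have p0 := prime_gt0 pp; have p1 := prime_gt1 pp.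
have a0 : 0 < a by case: a pa {F0k} => //; rewrite dvdn0.
have [i ip /dvdnP[c cE]] := exists_multiple b pp pa.
have pn : p <= n by nia.
pose m := (n - i + p.-1) %/ p.
have [m1 m2] : n - i <= m * p /\ m * p < n - i + p.
  by have := divn_eq (n - i + p.-1) p; have := ltn_pmod (n - i + p.-1) p0; rewrite -/m; lia.
have km : k <= m by rewrite -ltnS -(ltn_pmul2r p0) mulSn; lia.
exists c, m; split=> //.
- by lia.
- by case: c cE => //; lia.
- by rewrite -cE ltn_add2r ltn_pmul2l.
apply: (dvdn_coef pp _ _ F0k); last by rewrite size_ap k0.
by apply: (filter_ap pp pa cE ip); lia.
Qed.

Lemma fc_pred_size x s : fc (x :: s) (size s) = sumn (x :: s).
Proof.
elim: s x => [|y s IHs] x; first by rewrite /= muln1.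
transitivity (x * fc (y :: s) (size (y :: s)) + fc (y :: s) (size s)); first by [].
by rewrite fc_size muln1 IHs.
Qed.

Lemma sumn_ap a c m : 2 * sumn (ap a c m.+1) = m.+1 * (2 * c + a * m).
Proof.
elim: m c => [|m IHm] c; first by rewrite /ap /=; lia.
by rewrite apS /= mulnDr IHm; ring.
Qed.

(** Only m = k and m = k + 1 are possible. The coefficient is 1 in the first case; in the second,
    twice it is (k + 1) (2 c + a k), and the bound on b makes 2 c + a k < p. *)
Lemma simple_criterion a b n k p : 0 < a -> 0 < b -> 0 < k -> prime p ->
  k * p <= n -> n < k.+1 * p -> k.+1 < p -> a < p -> 2 * b + a * (k + 2) * p <= p * p ->
  ~~ (fc (ap a b n) 0 %| fc (ap a b n) k).
Proof.
move=> a0 b0 k0 pp kn nk kp ap' bp; apply/negP => F0k.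
have p0 := prime_gt0 pp.
have pa : ~~ (p %| a) by apply/negP => /(dvdn_leq a0); lia.
have [c [m [km mp c0 cp]]] := window b0 pp pa k0 kn F0k.
have mk : m <= k.+1 by rewrite -ltnS -(ltn_pmul2r p0) (leq_trans mp) // mulSn addnC leq_add2l ltnW.
have small d : 0 < d -> d < p -> p %| d -> False by move=> d0 dp /(dvdn_leq d0); lia.
have [->|mk'] := eqVneq m k; first by rewrite -[X in fc _ X](size_ap a c) fc_size => /small; lia.
have {mk mk' km} -> : m = k.+1 by lia.
rewrite apS -{2}(size_ap a (a + c) k) fc_pred_size -apS => /(dvdn_mull 2).
rewrite sumn_ap Euclid_dvdM // => /orP[|] /small; first by lia.
by case; rewrite ?addn_gt0 ?muln_gt0 ?c0 // -(ltn_pmul2r p0); nia.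
Qed.

Lemma prod_primes_dvdn (r : seq nat) (Q : nat) : uniq r ->
  (forall p, p \in r -> prime p && (p %| Q)) -> \prod_(p <- r) p %| Q.
Proof.
elim: r => [|p r IHr]; first by rewrite big_nil dvd1n.
move=> /= /andP[pr ur] H; rewrite big_cons Gauss_dvd.
  have /andP[_ ->] := H p (mem_head _ _); apply: IHr => // q qr.
  by apply: H; rewrite inE qr orbT.
have /andP[pp _] := H p (mem_head _ _).
rewrite big_seq; elim/big_ind: _ => [|x y px py|q qr]; first exact: coprimen1.
  by rewrite coprimeMr px.
have /andP[qq _] : prime q && (q %| Q) by apply: H; rewrite inE qr orbT.
by rewrite prime_coprime //; apply: contra pr; rewrite dvdn_prime2 // => /eqP->.
Qed.

(** * Chebyshev's estimate and large n *)

(** From n to n + 1 the right side is multiplied by 2 (2 n + 1) / n > 4. *)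
Lemma bin_central_ge n : 0 < n -> 4 ^ n <= 2 * n * 'C(2 * n, n).
Proof.
elim: n => // n IHn _; have [->|n0] := posnP n; first by [].
have {}IHn := IHn n0.
have E : n.+1 * 'C(2 * n.+1, n.+1) = 2 * (2 * n).+1 * 'C(2 * n, n).
  have h1 := mul_bin_diag (2 * n).+1 n.
  have h2 := mul_bin_left (2 * n) n.
  have h3 := binS (2 * n) n.
  have h4 : 2 * n - n = n by lia.
  rewrite h4 in h2.
  have h5 : 'C((2 * n).+1, n.+1) * n.+1 = (2 * n).+1 * 'C(2 * n, n).
    rewrite h3 mulnDl [_ * n.+1]mulnC h2; nia.
  rewrite (_ : 2 * n.+1 = (2 * n).+2) -?mul_bin_diag; last by lia.
  have := bin_sub (n := (2 * n).+1) (m := n.+1); rewrite (_ : (2 * n).+1 - n.+1 = n); last by lia.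
  move=> h6; rewrite h6 in h1 *; last by lia.
  nia.
rewrite expnS -(leq_pmul2r n0); nia.
Qed.

(** Legendre's formula for (2 n)! and n!, the sum for n! being extended by zero terms. *)
Lemma logn_bin_central p n : prime p ->
  logn p 'C(2 * n, n) = \sum_(1 <= i < (2 * n).+1) (2 * n %/ p ^ i - 2 * (n %/ p ^ i)).
Proof.
move=> pp; have p0 := prime_gt0 pp.
have := congr1 (logn p) (bin_fact (leq_addl n n : n <= n + n)).
rewrite addnK addnn -mul2n !lognM ?muln_gt0 ?bin_gt0 ?fact_gt0 //; try lia.
rewrite !logn_fact // => E.
have wide : \sum_(1 <= i < n.+1) n %/ p ^ i = \sum_(1 <= i < (2 * n).+1) n %/ p ^ i.
  rewrite [RHS](@big_cat_nat _ _ _ n.+1) //=; last by lia.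
  rewrite [X in _ + X]big_nat_cond [X in _ + X]big1 ?addn0 // => i /andP[/andP[ni _] _].
  by rewrite divn_small // (leq_trans ni) // ltnW // ltn_expl // prime_gt1.
rewrite wide in E; have key : \sum_(1 <= i < (2 * n).+1) (2 * n %/ p ^ i - 2 * (n %/ p ^ i)) +
  2 * \sum_(1 <= i < (2 * n).+1) n %/ p ^ i = \sum_(1 <= i < (2 * n).+1) 2 * n %/ p ^ i.
  rewrite big_distrr -big_split /=; apply: eq_bigr => i _.
  by rewrite subnK // leq_divRL ?expn_gt0 ?p0 // -mulnA leq_mul2l leq_trunc_div orbT.
by apply: (@addIn (2 * \sum_(1 <= i < (2 * n).+1) n %/ p ^ i)); rewrite key -E; lia.
Qed.

Lemma divn_double_le1 n d : 0 < d -> 2 * n %/ d - 2 * (n %/ d) <= 1.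
Proof.
move=> d0; rewrite leq_subLR -ltnS ltn_divLR //.
by have := ltn_ceil n d0; nia.
Qed.

(** Each term of Legendre's sum is at most 1, and it vanishes once p^i > 2 n. *)
Lemma pfactor_bin_central_le p n : prime p -> 0 < n -> p ^ logn p 'C(2 * n, n) <= 2 * n.
Proof.
move=> pp n0; have p1 := prime_gt1 pp.
have tl : p ^ trunc_log p (2 * n) <= 2 * n by apply: trunc_logP => //; lia.
apply: leq_trans tl; rewrite leq_exp2l // logn_bin_central //.
rewrite (@big_cat_nat _ _ _ (trunc_log p (2 * n)).+1) //=; last first.
  by rewrite ltnS; apply: ltnW; apply: (leq_trans (ltn_expl _ p1)); apply: trunc_logP => //; lia.
rewrite [X in _ + X]big_nat_cond [X in _ + X]big1 ?addn0 => [|i /andP[/andP[li _] _]].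
  apply: leq_trans (_ : \sum_(1 <= i < (trunc_log p (2 * n)).+1) 1 <= _).
    by apply: leq_sum => i _; apply: divn_double_le1; rewrite expn_gt0 ltnW.
  by rewrite sum_nat_const_nat subn1 muln1.
rewrite divn_small // (leq_trans (trunc_log_ltn _ p1)) // leq_exp2l //.
Qed.

Lemma logn_bin_central_le1 p n : prime p -> 2 * n < p ^ 2 -> logn p 'C(2 * n, n) <= (2 * n %/ p - 2 * (n %/ p)).
Proof.
move=> pp np; have p1 := prime_gt1 pp; rewrite logn_bin_central //.
have [->|n0] := posnP n; first by rewrite big_geq.
rewrite big_ltn ?ltnS ?muln_gt0 //= expn1 [X in _ + X]big_nat_cond [X in _ + X]big1 ?addn0 // => i /andP[/andP[i2 _] _].
by rewrite divn_small // (leq_trans np) // leq_exp2l.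
Qed.

Lemma prime_dvd_fact p n : prime p -> (p %| n`!) = (p <= n).
Proof.
move=> pp; elim: n => [|n IHn]; first by rewrite dvdn1 leqNgt prime_gt0 // gtn_eqF ?prime_gt1.
rewrite factS Euclid_dvdM // IHn; apply/orP/idP => [[/dvdn_leq->//|/leqW//]|].
by rewrite leq_eqVlt => /orP[/eqP->|]; [left | right].
Qed.

Definition prime_prod m n := \prod_(m <= p < n | prime p) p.

(** Erdős's induction. An even n > 2 is not prime. For n = 2 h + 1, the primes in ]h + 1, n] divide
    C(n, h + 1), which equals C(n, h) and so is at most 2^n / 2 = 4^h. *)
Lemma primorial_le n : prime_prod 0 n.+1 <= 4 ^ n.
Proof.
have [m] := ubnP n; elim: m n => // m IHm n nm.
have [n2|n2] := leqP n 2.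
  by case: n n2 nm => [|[|[|]]] //= _ _; rewrite /prime_prod unlock.
have [h on] : exists h, (n = h.*2 \/ n = h.*2.+1) by exists n./2; have := odd_double_half n; case: odd; lia.
case: on => nE.
  have -> : prime_prod 0 n.+1 = prime_prod 0 n.
    rewrite /prime_prod big_mkcond big_nat_recr //= -big_mkcond /=.
    case: ifP => [pn|_]; last by rewrite muln1.
    by case: (even_prime pn) => [?|]; [lia | rewrite nE odd_double].
  rewrite (_ : n = n.-1.+1); last by lia.
  by apply: leq_trans (IHm n.-1 _) _; rewrite ?leq_exp2l //; lia.
rewrite /prime_prod (@big_cat_nat _ _ _ h.+2) //=; last by lia.
have -> : 4 ^ n = 4 ^ h.+1 * 4 ^ h by rewrite -expnD; congr (_ ^ _); lia.
apply: leq_mul; first by apply: IHm; lia.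
apply: leq_trans (_ : 'C(n, h.+1) <= _).
  apply: dvdn_leq; first by rewrite bin_gt0; lia.
  rewrite -big_filter; apply: prod_primes_dvdn => [|p].
    by rewrite filter_uniq // iota_uniq.
  rewrite mem_filter mem_index_iota => /andP[pp /andP[hp pn]]; rewrite pp /=.
  have hn : h.+1 <= n by lia.
  have : p %| 'C(n, h.+1) * (h.+1`! * (n - h.+1)`!).
    by rewrite bin_fact // dvdn_fact // prime_gt0.
  rewrite Euclid_dvdM // (@Euclid_dvdM (h.+1)`! _ p) // !prime_dvd_fact // => /or3P[//|pl|pl]; have := leq_trans hp pl; lia.
have e : h = n - h.+1 by lia.
have E : 'C(n, h.+1) = 'C(n, h) by rewrite [in RHS]e bin_sub //; lia.
have := Pascal 1 1 n; rewrite addn1 => P.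
have : 2 ^ n = \sum_(i < n.+1) 'C(n, i).
  by rewrite P; apply: eq_bigr => i _; rewrite !exp1n !muln1.
have -> : 2 ^ n = 2 * 4 ^ h by rewrite nE expnS -mul2n expnM.
rewrite (bigD1 (inord h)) //= (bigD1 (inord h.+1)) /=; last first.
  by rewrite -val_eqE /= !inordK; lia.
rewrite !inordK ?E; lia.
Qed.

(** Here s is the integer square root of 2 x, or larger. Primes up to s contribute at most 2 x each;
    larger ones contribute at most p, and nothing when 2 x / 3 < p <= x or p > 2 x. *)
Lemma pfactor_bin_central_cases x s p : 0 < x -> 2 * x < s.+1 ^ 2 ->
  p ^ logn p 'C(2 * x, x) <= (if 0 < p < s.+1 then 2 * x else 1) *
    (if prime p && (p < (2 * x %/ 3).+1) then p else 1) *
    (if prime p && (p < (2 * x).+1) && (x < p) then p else 1).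
Proof.
move=> x0 xs; have [pp|] := boolP (prime p); last first.
  by move=> npp; rewrite lognE (negPf npp) /= !muln1; case: ifP => // _; lia.
have p1 := prime_gt1 pp; rewrite (prime_gt0 pp) /=.
have [ps|ps] := ltnP p s.+1.
  rewrite -mulnA; apply: leq_trans (pfactor_bin_central_le pp x0) _.
  by rewrite leq_pmulr // muln_gt0; do 2 case: ifP => _ //; lia.
rewrite mul1n; have p2 : 2 * x < p ^ 2 by apply: leq_trans xs _; rewrite leq_exp2r.
have := logn_bin_central_le1 pp p2; set l := logn _ _ => ld.
have d1 := divn_double_le1 x (prime_gt0 pp).
have l1 : l <= 1 by apply: leq_trans ld d1.
have ple : p ^ l <= p by rewrite -[leqRHS]expn1 leq_exp2l.
have [px|px] := leqP p x.
  rewrite andbF muln1; case: ifP => [//|/negbT]; rewrite -leqNgt => p3.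
  have e1 : 1 <= x %/ p by rewrite leq_divRL ?mul1n // ltnW.
  have e2 : 2 * x %/ p < 3.
    by rewrite ltn_divLR ?prime_gt0 // -[3 * p]mulnC -ltn_divLR.
  by have -> : l = 0; [lia | rewrite expn0; lia].
have [p2x|p2x] := ltnP p (2 * x).+1.
  by rewrite andbT; apply: leq_trans ple _; rewrite leq_pmull //; case: ifP => _ //; lia.
have -> : l = 0 by move: ld; rewrite divn_small // leqn0 => /eqP.
by rewrite /= muln1; case: ifP => _ //; lia.
Qed.

Lemma prime_prod_window x s : 0 < x -> s ^ 2 <= 2 * x < s.+1 ^ 2 ->
  4 ^ x <= (2 * x) ^ s.+1 * 4 ^ (2 * x %/ 3) * prime_prod x.+1 (2 * x).+1.
Proof.
move=> x0 /andP[sx xs]; apply: leq_trans (bin_central_ge x0) _.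
(* One of the s + 1 factors 2 x pays for the factor 2 x in [bin_central_ge]. *)
rewrite expnS -!mulnA !leq_mul2l; apply/orP; right; apply/orP; right.
set C := 'C(_, _); have C0 : 0 < C by rewrite bin_gt0; lia.
(* A common upper limit for the factorization of C and for the three ranges of primes. *)
pose M := maxn (2 * x) C; have CM : C <= M by apply: leq_maxr.
have xM : 2 * x <= M by apply: leq_maxl.
have sx' : s <= 2 * x by apply: leq_trans sx; rewrite -mulnn; nia.
rewrite -[leqLHS](partnT C0) (widen_partn predT CM).
apply: leq_trans (_ : \prod_(0 <= p < M.+1) ((if 0 < p < s.+1 then 2 * x else 1) *
    (if prime p && (p < (2 * x %/ 3).+1) then p else 1) *
    (if prime p && (p < (2 * x).+1) && (x < p) then p else 1)) <= _).
  by apply: leq_prod => p _; apply: pfactor_bin_central_cases.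
rewrite !big_split /= -!big_mkcond /= -mulnA.
apply: leq_mul.
  rewrite -(@big_nat_widen _ _ _ _ _ _ (fun p => 0 < p)) //; last by lia.
  by rewrite -(@big_nat_widenl _ _ _ 1 0 s.+1 predT) // prod_nat_const_nat subn1.
apply: leq_mul; last first.
  rewrite (eq_bigl (fun p => (prime p && (x < p)) && (p < (2 * x).+1))); last first.
    by move=> p; rewrite andbAC.
  rewrite -(@big_nat_widen _ _ _ _ _ _ (fun p => prime p && (x < p))) //.
  by rewrite -(@big_nat_widenl _ _ _ _ _ _ prime).
rewrite -(@big_nat_widen _ _ _ _ _ _ prime); first exact: primorial_le.
by rewrite ltnS (leq_trans _ xM) // leq_div.
Qed.

Lemma sqrt_exists n : exists s, s ^ 2 <= n < s.+1 ^ 2.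
Proof.
elim: n => [|n [s /andP[s1 s2]]]; first by exists 0.
have [h|h] := ltnP n.+1 (s.+1 ^ 2); first by exists s; rewrite h andbT ltnW.
by exists s.+1; move: h s2; rewrite -!mulnn; nia.
Qed.

(* 45 * L + 66 bounds 20 k and 20 a k when n < 2 ^ L.+1. *)
Lemma exp_gt_cubic L : 27 <= L ->
  2 * (45 * L + 66) * (24 * (L - 19) * (45 * L + 66) ^ 2 + 400) <= 8 * 1000 * 2 ^ L.
Proof.
move=> L27; rewrite -(subnK L27); elim: (L - 27) => [|t IHt].
  have -> : 2 ^ (0 + 27) = 512 * (512 * 512) by rewrite -[512]/(2 ^ 9) -!expnD.
  by rewrite -mulnn; lia.
rewrite addSn (expnS _ (t + 27)) [X in _ <= X]mulnCA; apply: leq_trans (leq_mul (leqnn 2) IHt).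
have -> : t + 27 - 19 = t + 8 by lia.
have -> : (t + 27).+1 - 19 = t + 9 by lia.
have -> : 45 * (t + 27).+1 + 66 = 45 * t + 1326 by lia.
have -> : 45 * (t + 27) + 66 = 45 * t + 1281 by lia.
rewrite !expnS !expn0; nia.
Qed.

(** Since 20 a k <= 45 L + 66, this makes the base 2 a k + 6 of [ap_prod_le] at most 2^(L - 19). *)
Lemma exp_gt_linear L : 27 <= L -> 45 * L + 126 <= 10 * 2 ^ (L - 19).
Proof.
move=> L27; rewrite -(subnK L27); elim: (L - 27) => [|t IHt]; first by [].
have -> : t.+1 + 27 - 19 = (t + 27 - 19).+1 by lia.
by rewrite expnS; lia.
Qed.

(** All the coefficients a prime of the window may divide: m = k + 1 + j runs over k < m <= 2 k, and
    the first quotient over 1, ..., a + 5. *)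
Definition ap_prod (a k : nat) := \prod_(j < k) \prod_(c < a + 5) fc (ap a c.+1 (k.+1 + j)) k.

Lemma ap_prod_gt0 a k : 0 < ap_prod a k.
Proof.
apply: prodn_gt0 => j; apply: prodn_gt0 => c.
by apply: fc_gt0_le; [apply: ap_gt0 | rewrite size_ap; lia].
Qed.

(** Evaluation at X = 1 bounds each coefficient by a product of at most 2 k factors, each at most (a
    + 5) + a (2 k - 1) + 1 = 2 a k + 6. *)
Lemma ap_prod_le a k : ap_prod a k <= (2 * (a * k) + 6) ^ (2 * k * (k * (a + 5))).
Proof.
have H (j : 'I_k) (c : 'I_(a + 5)) : fc (ap a c.+1 (k.+1 + j)) k <= (2 * (a * k) + 6) ^ (2 * k).
  apply: leq_trans (_ : (2 * (a * k) + 6) ^ (k.+1 + j) <= _); last first.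
    by rewrite leq_pexp2l //; have := ltn_ord j; lia.
  have := fc_eval (ap a c.+1 (k.+1 + j)) k 1; rewrite exp1n muln1 => /leq_trans; apply.
  rewrite -[X in _ ^ X](size_ap a c.+1 (k.+1 + j)).
  rewrite -(iter_muln_1 _ (size _)) -[size _]count_predT -big_const_seq.
  rewrite big_seq [leqRHS]big_seq; apply: leq_prod => t /mapP[i].
  rewrite mem_iota add0n => /andP[_ ij] ->.
  by have := ltn_ord j; have := ltn_ord c; nia.
apply: leq_trans (_ : \prod_(j < k) \prod_(c < a + 5) (2 * (a * k) + 6) ^ (2 * k) <= _).
  by apply: leq_prod => j _; apply: leq_prod => c _; apply: H.
by rewrite !prod_nat_const !card_ord -!expnM; apply: eq_leq; congr (_ ^ _); lia.
Qed.

(** * Contradiction for n >= 2^27 *)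

Section LargeN.

Variables (a b n k : nat).
Hypotheses (a0 : 0 < a) (b0 : 0 < b) (k0 : 0 < k) (kn : k <= n) (n1 : 1 < n).
Hypothesis F0k : fc (ap a b n) 0 %| fc (ap a b n) k.
Let x := n %/ (2 * k).

Let n'E : n = n.-1.+1. Proof. by lia. Qed.

Lemma ab_le : k * (a + b) <= 3 * n.-1.
Proof. by apply: bound_ab; rewrite -?n'E //; lia. Qed.

Lemma a_le : 20 * a * k <= 3 * (15 * trunc_log 2 n.-1 + 22).
Proof. by apply: (@bound_a a b); rewrite -?n'E //; lia. Qed.

(** The window x < p <= 2 x gives k p <= n < 2 k p, so k <= m <= 2 k; m = k is excluded because the
    coefficient is then 1. *)
Lemma prime_dvd_ap_prod p : prime p -> x < p <= 2 * x -> a < p -> p %| ap_prod a k.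
Proof.
move=> pp /andP[xp px] ap'; have p0 := prime_gt0 pp.
have pa : ~~ (p %| a) by apply/negP => /(dvdn_leq a0); lia.
have xn : x * (2 * k) <= n by rewrite leq_trunc_div.
have nx : n < x.+1 * (2 * k) by rewrite ltn_ceil // muln_gt0.
have kp : k * p <= n by apply: leq_trans xn; rewrite mulnA [x * 2]mulnC mulnC leq_mul2r px orbT.
have np : n < 2 * k * p by apply: leq_trans nx _; rewrite mulnC leq_mul2l xp orbT.
have [c [m [km mp c0 cp pf]]] := window b0 pp pa k0 kp F0k.
have m2k : m <= 2 * k by rewrite -ltnS -(ltn_pmul2r p0) mulSn; lia.
(* [ab_le] gives k b < 3 n < 6 k p, so b < 6 p. *)
have c6 : c < a + 6.
  rewrite -(ltn_pmul2r p0) (leq_trans cp) // mulnDl leq_add2l.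
  rewrite -(leq_pmul2l k0); have := ab_le; rewrite mulnDr; nia.
have km' : k < m.
  rewrite ltn_neqAle km andbT; apply/negP => /eqP kmE; move: pf.
  by rewrite -kmE -[X in fc _ X](size_ap a c k) fc_size dvdn1 => /eqP p1; rewrite p1 in pp.
have jk : m - k.+1 < k by lia.
have ca : c.-1 < a + 5 by lia.
rewrite /ap_prod (bigD1 (Ordinal jk)) // (bigD1 (Ordinal ca)) //.
rewrite -[nat_of_ord (Ordinal jk)]/(m - k.+1) -[nat_of_ord (Ordinal ca)]/c.-1.
rewrite (subnKC km') prednK //.
by apply: dvdn_mulr; apply: dvdn_mulr.
Qed.

(** Base-2 logarithms of the two bounds for the product of the primes in ]x, 2 x] give 2 x <= (L +
    1) (s + 1) + 4 x / 3 + (L - 19) E. The last term is below x / 2, so x <= 6 (L + 1) (s + 1); as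
    s^2 <= 2 x, x is at most quadratic in L, against the cubic lower bound [xbig]. *)
Lemma large_n : n < 2 ^ 27.
Proof.
rewrite ltnNge; apply/negP => n27.
have dvdQ := prime_dvd_ap_prod; have ale := a_le; move: F0k => _.
pose L := trunc_log 2 n; have n0 : 0 < n by lia.
have L27 : 27 <= L by apply: trunc_log_max.
have nL : 2 ^ L <= n by apply: trunc_logP.
have nL' : n < 2 ^ L.+1 by apply: trunc_log_ltn.
have ak : 20 * (a * k) <= 45 * L + 66.
  have : trunc_log 2 n.-1 <= L by apply: leq_trunc_log; lia.
  by lia.
have kL : 20 * k <= 45 * L + 66 by apply: leq_trans ak; rewrite leq_mul2l leq_pmull.
have nx : n < x.+1 * (2 * k) by rewrite ltn_ceil // muln_gt0.
have xbig : 24 * (L - 19) * (45 * L + 66) ^ 2 < 400 * x.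
  rewrite -(ltn_add2r 400) -(ltn_pmul2l (_ : 0 < 2 * (45 * L + 66))); last by lia.
  apply: leq_ltn_trans (exp_gt_cubic L27) _.
  apply: leq_ltn_trans (leq_mul (leqnn (8 * 1000)) nL) _.
  apply: leq_trans (_ : 8 * 1000 * (x.+1 * (2 * k)) <= _).
    by rewrite ltn_pmul2l.
  rewrite (_ : 8 * 1000 * _ = x.+1 * 800 * (20 * k)); last by lia.
  by apply: leq_trans (leq_mul (leqnn _) kL) _; lia.
set h := 45 * L + 66 in ak kL xbig.
have L19 : 8 <= L - 19 by lia.
have hL : 45 * L.+1 <= h by rewrite /h; lia.
have x0 : 0 < x by lia.
have h3 : 3 <= h by rewrite /h; lia.
have ax : a < x.
  have : a <= a * k by apply: leq_pmulr.
  have h2 : 3 * h <= h * h by apply: leq_mul.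
  have := leq_mul (leq_mul (leqnn 24) L19) (leqnn (h * h)); rewrite -mulnn in xbig; lia.
have x2n : 2 * x <= n.
  by apply: leq_trans (leq_trunc_div n (2 * k)); rewrite -/x mulnC leq_mul2l leq_pmulr ?orbT.
have [s /andP[s1 s2]] := sqrt_exists (2 * x).
have PQ : prime_prod x.+1 (2 * x).+1 <= ap_prod a k.
  apply: dvdn_leq; first exact: ap_prod_gt0.
  rewrite /prime_prod -big_filter; apply: prod_primes_dvdn => [|p].
    by rewrite filter_uniq // iota_uniq.
  rewrite mem_filter mem_index_iota => /andP[pp xp]; rewrite pp.
  by apply: dvdQ => //; case/andP: xp => /(ltn_trans ax).
pose E := 2 * k * (k * (a + 5)).
have QE : ap_prod a k <= 2 ^ ((L - 19) * E).
  apply: leq_trans (ap_prod_le a k) _; rewrite -/E expnM leq_exp2r; last first.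
    by rewrite !muln_gt0 k0 addnS.
  rewrite -(leq_pmul2l (_ : 0 < 10)) //; apply: leq_trans (exp_gt_linear L27).
  by rewrite /h in ak; lia.
have : 4 ^ x <= 2 ^ (L.+1 * s.+1 + 2 * (2 * x %/ 3) + (L - 19) * E).
  have sx : s ^ 2 <= 2 * x < s.+1 ^ 2 by rewrite s1.
  apply: leq_trans (prime_prod_window x0 sx) _.
  rewrite 2!expnD; apply: leq_mul; last exact: leq_trans PQ QE.
  rewrite (expnM 2 L.+1) (expnM 2 2).
  rewrite leq_mul2r leq_exp2r // ltnW ?orbT //; exact: leq_ltn_trans nL'.
rewrite -[4]/(2 ^ 2) -expnM leq_exp2l // => main.
have q3 : 3 * (2 * x %/ 3) <= 2 * x by rewrite mulnC leq_trunc_div.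
have EL : 2 * ((L - 19) * E) < x.
  have E6 : 400 * E <= 12 * h ^ 2.
    have e1 : 20 * (a * k) * (20 * k) <= h * h by apply: leq_mul.
    have e2 : 20 * k * (20 * k) <= h * h by apply: leq_mul.
    by rewrite /E -mulnn; lia.
  have := leq_mul (leqnn (2 * (L - 19))) E6; lia.
have xs : x <= 6 * (L.+1 * s.+1) by lia.
have sL : s <= 12 * L.+1.
  rewrite leqNgt; apply/negP => sL; rewrite -mulnn in s1.
  have s3 : s * s <= 12 * (L.+1 * s.+1) by lia.
  have := leq_trans (leq_mul sL (leqnn s)) s3.
  by move: L.+1 sL => t; clear; lia.
have : x <= 6 * (L.+1 * (12 * L.+1).+1).
  by apply: leq_trans xs _; rewrite !leq_mul2l ltnS sL !orbT.
have hh : 45 * L.+1 * (45 * L.+1) <= h * h by apply: leq_mul.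
have tt : L.+1 * 1 <= L.+1 * L.+1 by rewrite leq_mul2l.
have := leq_mul (leq_mul (leqnn 24) L19) hh; rewrite -mulnn in xbig.
move/leq_ltn_trans/(_ xbig); move: L.+1 tt => t; clear; lia.
Qed.

End LargeN.

(** * Computation for n < 2^27 *)

Local Open Scope N_scope.

(* 15 * log2 m + 22 bounds 20 times the m-th harmonic number. *)
Definition amax (k n : N) : N :=
  let h := 15 * N.log2 (n - 1) + 22 in
  if k =? 1 then h / 10 else if k =? 2 then h / 14 else 3 * h / (20 * k).

(* A necessary condition for S_{a,b}(n, k) >= 1; t3 and ak stand for 3 ^ k and a ^ k. *)
Definition permit (k t3 n a ak b : N) : bool :=
  if (if k =? 1 then a + b <=? 2 * (n - 1) else k * (a + b) <=? 3 * (n - 1)) then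
    (if a =? 1 then t3 * (b * (b + 1) * (b + 2)) <=? (n + b) * (n + b + 1) * (n + b + 2)
     else ak * b <=? a * n + b)
  else false.

(** Conditionals stand for boolean connectives in these tests, so that call-by-value evaluation
    stops at the first decisive value. *)
Fixpoint all_from (f : N -> bool) (fuel : nat) (a : N) : bool :=
  if fuel is S fuel' then if f a then all_from f fuel' (a + 1) else false else true.

Fixpoint any_of (f : N -> bool) (l : seq N) : bool :=
  if l is x :: l' then if f x then true else any_of f l' else false.

(** Testing b = 1 at this n covers all b and all smaller n: [permit] is decreasing in b and
    increasing in n, and [amax] is increasing in n. *)
Definition no_permit (k t3 n : N) : bool :=
  all_from (fun a => ~~ permit k t3 n a (a ^ k) 1) (N.to_nat (amax k n)) 1.

(** Settles all n in [k p, (k + 1) p) at once; [nm] is the largest. For each a, [simple_criterion]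
    reaches b = (p^2 - a (k + 2) p) / 2, so the next b must not be permitted. *)
Definition good_prime (k t3 p : N) : bool :=
  let nm := (k + 1) * p - 1 in
  if k + 1 <? p then
    all_from (fun a => let ak := a ^ k in
      if permit k t3 nm a ak 1 then
        if a * (k + 2) <? p then
          ~~ permit k t3 nm a ak ((p * p - a * (k + 2) * p) / 2 + 1)
        else false
      else true) (N.to_nat (amax k nm)) 1
  else false.

(* The least quotient c' >= c such that c' * p is congruent to b modulo a. *)
Fixpoint find_quot (a b p : N) (fuel : nat) (c : N) : N :=
  if fuel is S fuel' then
    if (c * p - b) mod a =? 0 then c else find_quot a b p fuel' (c + 1)
  else c.

(** Multiplication by 1 + x X modulo p of a truncated polynomial, constant term first; [prev] is the
    preceding coefficient. *)
Fixpoint mul_1aX (p x prev : N) (l : seq N) : seq N :=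
  if l is h :: t then (h + x * prev) mod p :: mul_1aX p x h t else [::].

Fixpoint esym_ap (p a : N) (m : nat) (c : N) (j : nat) : seq N :=
  if m is S m' then mul_1aX p c 0 (esym_ap p a m' (c + a) j) else 1 :: nseq j 0.

(** The coefficient of X^k in a product of m factors t + X is the elementary symmetric function of
    degree m - k, a small degree when m is close to k. The test a i0 + b = c p certifies the value
    of [find_quot]. *)
Definition prime_witness (a b n k p : N) : bool :=
  if a mod p =? 0 then false else
  let c := find_quot a b p (N.to_nat a) ((b + p - 1) / p) in
  let i0 := (c * p - b) / a in
  if ~~ (a * i0 + b =? c * p) then false else
  if p <=? i0 then false else if n <=? i0 then false else
  let m := (n - 1 - i0) / p + 1 in
  if m <? k then false else if m =? k then true else
  ~~ (last 0 (esym_ap p a (N.to_nat m) c (N.to_nat (m - k))) mod p =? 0).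

Fixpoint mul_aX (M x prev : N) (l : seq N) : seq N :=
  if l is h :: t then (x * h + prev) mod M :: mul_aX M x h t else [::].

Fixpoint coef_ap (M a : N) (m : nat) (c : N) (j : nat) : seq N :=
  if m is S m' then mul_aX M c 0 (coef_ap M a m' (c + a) j) else 1 :: nseq j 0.

Definition modulus_witness (a b n k M : N) : bool :=
  let l := coef_ap M a (N.to_nat n) b (N.to_nat k) in
  if head 0 l mod M =? 0 then ~~ (last 0 l mod M =? 0) else false.

(** From a decreasing list, up to four primes around q = n / k, starting with the last one above q
    if there is one: these have about k multiples among the terms. *)
Fixpoint candidates (q : N) (l : seq N) : seq N :=
  match l with
  | p :: ((p' :: _) as l') => if q <? p' then candidates q l' else take 4 l
  | _ => l
  end.

Definition exceptional (a b n k : N) : bool :=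
  if a =? 1 then if b =? 1 then if n =? 3 then k =? 2 else false else false else false.

Definition tuple_ok (a b n k : N) (cs : seq N) : bool :=
  if any_of (prime_witness a b n k) cs then true else
  if exceptional a b n k then true else
  any_of (modulus_witness a b n k) [:: 1001; 15; 23; 16; 7; 3].

(** Stops at the first b that is not permitted, as no larger one is. *)
Fixpoint all_b (k t3 n a ak : N) (cs : seq N) (fuel : nat) (b : N) : bool :=
  if fuel is S fuel' then
    if permit k t3 n a ak b then
      if tuple_ok a b n k cs then all_b k t3 n a ak cs fuel' (b + 1) else false
    else true
  else true.

Definition check_n (sm : seq N) (k t3 n : N) : bool :=
  let cs := candidates (n / k) sm in
  let f := N.to_nat (2 * n) in
  all_from (fun a => all_b k t3 n a (a ^ k) cs f 1) (N.to_nat (amax k n)) 1.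

Definition check_range (sm : seq N) (k t3 lo hi : N) : bool :=
  all_from (check_n sm k t3) (N.to_nat (hi - lo)) lo.

(** All n from the start up to [cur] are settled. A prime is skipped if its interval ends by [cur]
    or the next prime's interval begins by then; otherwise the gap before k p is checked tuple by
    tuple, and [k p, (k + 1) p) by [good_prime] or tuple by tuple. *)
Fixpoint walk (N0 : N) (sm : seq N) (k t3 : N) (ps : seq N) (cur : N) : bool :=
  if N0 <=? cur then true else
  if ps is p :: ps' then
    if (k + 1) * p <=? cur then walk N0 sm k t3 ps' cur else
    if (if ps' is p' :: _ then k * p' <=? cur else false)
    then walk N0 sm k t3 ps' cur else
    let c1 := N.max cur (k * p) in
    if check_range sm k t3 cur c1 then
      if (if good_prime k t3 p then true else check_range sm k t3 c1 ((k + 1) * p))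
      then walk N0 sm k t3 ps' ((k + 1) * p) else false
    else false
  else false.

Definition check_k (N0 : N) (chain sm : seq N) (k n0 : N) : bool :=
  let t3 := 3 ^ k in
  if (if n0 =? 2 then true else if 1 <? n0 then no_permit k t3 (n0 - 1) else false)
  then walk N0 sm k t3 chain n0 else false.

Fixpoint trial (p : N) (fuel : nat) (d : N) : bool :=
  if fuel is S fuel' then
    if p <? d * d then true else if p mod d =? 0 then false else
    if p mod (d + 2) =? 0 then false else trial p fuel' (d + 6)
  else false.

(** The fuel 1500 lets d reach 8999, beyond the square root of the largest prime tested,
    68265377. *)
Definition is_prime (p : N) : bool :=
  if p <? 5 then (if p =? 2 then true else p =? 3) else
  if p mod 2 =? 0 then false else if p mod 3 =? 0 then false else trial p 1500 5.

Local Close Scope N_scope.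

Local Notation "# x" := (N.to_nat x) (at level 2, x at level 2, format "# x").

(** * Correctness of the tests, by translation from binary to natural numbers *)

Lemma to_natD x y : #(x + y)%num = #x + #y. Proof. exact: N2Nat.inj_add. Qed.
Lemma to_natM x y : #(x * y)%num = #x * #y. Proof. exact: N2Nat.inj_mul. Qed.
Lemma to_natB x y : #(x - y)%num = #x - #y. Proof. exact: N2Nat.inj_sub. Qed.
Lemma to_natX x y : #(x ^ y)%num = #x ^ #y.
Proof.
rewrite -(N2Nat.id y); elim: #y => [|m IHm]; first by [].
by rewrite Nat2N.inj_succ N.pow_succ_r' to_natM IHm N2Nat.inj_succ !Nat2N.id expnS.
Qed.
Lemma leb_to_nat x y : (x <=? y)%num = (#x <= #y). Proof. by apply/idP/idP; lia. Qed.
Lemma ltb_to_nat x y : (x <? y)%num = (#x < #y). Proof. by apply/idP/idP; lia. Qed.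
Lemma eqb_to_nat x y : (x =? y)%num = (#x == #y). Proof. by apply/idP/idP; lia. Qed.
Lemma to_nat_div_mod x y : #(x / y)%num = #x %/ #y /\ #(x mod y)%num = #x %% #y.
Proof.
have [->|y0] := N.eq_dec y 0; first by case: x.
have y0' : 0 < #y by lia.
have := N.div_mod' x y; have := N.mod_lt x y y0.
set q := (x / y)%num; set r := (x mod y)%num => ry xE.
have -> : #x = #q * #y + #r by rewrite -to_natM -to_natD; congr N.to_nat; lia.
by rewrite divnMDl // modnMDl divn_small ?modn_small ?addn0 //; lia.
Qed.
Lemma to_nat_div x y : #(x / y)%num = #x %/ #y. Proof. by case: (to_nat_div_mod x y). Qed.
Lemma to_nat_mod x y : #(x mod y)%num = #x %% #y. Proof. by case: (to_nat_div_mod x y). Qed.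
Lemma to_nat_log2 x : #(N.log2 x) = trunc_log 2 #x.
Proof.
have [->|x0] := N.eq_dec x 0; first by [].
have [] := N.log2_spec x; first by lia.
set l := N.log2 x => h1 h2; symmetry; apply: trunc_log_eq => //.
have -> : 2 ^ #l = #(2 ^ l)%num by rewrite to_natX.
have -> : 2 ^ (#l).+1 = #(2 ^ N.succ l)%num by rewrite to_natX N2Nat.inj_succ.
by lia.
Qed.

Lemma all_fromP f fuel a : all_from f fuel a ->
  forall c, #a <= #c -> #c < #a + fuel -> f c.
Proof.
elim: fuel a => [|fuel IHf] a /=; first by lia.
case: ifP => // fa /IHf{}IHf c ac ca.
have [E|ne] := eqVneq #a #c; first by rewrite -(N2Nat.inj _ _ E).
by apply: IHf; rewrite to_natD /=; lia.
Qed.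

Lemma any_ofP f l : any_of f l -> exists2 x, x \in l & f x.
Proof.
elim: l => //= x l IHl; case: ifP => [fx _|_ /IHl[y yl fy]].
  by exists x; rewrite ?mem_head.
by exists y; rewrite // inE yl orbT.
Qed.

Definition integral a b n k := fc (ap a b n) 0 %| fc (ap a b n) k.

Definition amaxn k n :=
  let h := 15 * trunc_log 2 (n - 1) + 22 in
  if k == 1 then h %/ 10 else if k == 2 then h %/ 14 else (3 * h) %/ (20 * k).

Definition permitn k n a b :=
  if (if k == 1 then a + b <= 2 * (n - 1) else k * (a + b) <= 3 * (n - 1)) then
    (if a == 1 then 3 ^ k * (b * (b + 1) * (b + 2)) <= (n + b) * (n + b + 1) * (n + b + 2)
     else a ^ k * b <= a * n + b)
  else false.

Lemma amaxE k n : #(amax k n) = amaxn #k #n.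
Proof.
rewrite /amax /amaxn !eqb_to_nat -[#1]/1 -[#2]/2; case: (_ == 1); last case: (_ == 2).
all: by rewrite !(to_nat_div, to_natM, to_natD, to_nat_log2, to_natB).
Qed.

Lemma permitE k t3 n a ak b : #t3 = 3 ^ #k -> #ak = #a ^ #k ->
  permit k t3 n a ak b = permitn #k #n #a #b.
Proof.
move=> t3E akE; rewrite /permit /permitn !(eqb_to_nat, leb_to_nat, to_natM, to_natD, to_natB) t3E akE -[#1]/1 -[#2]/2 -[#3]/3.
by [].
Qed.

Lemma permitn_monon k n n' a b : n <= n' -> permitn k n a b -> permitn k n' a b.
Proof.
move=> nn; rewrite /permitn.
case: ifP => // h1; have -> : (if k == 1 then a + b <= 2 * (n' - 1) else k * (a + b) <= 3 * (n' - 1)).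
  by move: h1; case: ifP => _ h1; apply: leq_trans h1 _; lia.
case: ifP => _ h2; apply: (leq_trans h2); last by rewrite leq_add2r leq_mul2l nn orbT.
by rewrite !leq_mul // !leq_add2r.
Qed.

(** The quotients (a n + b) / b and (n + b + j) / (b + j) decrease in b. *)
Lemma permitn_antib k n a b b' : 0 < b' <= b -> permitn k n a b -> permitn k n a b'.
Proof.
move=> /andP[b'0 bb]; rewrite /permitn.
case: ifP => // h1; have -> : (if k == 1 then a + b' <= 2 * (n - 1) else k * (a + b') <= 3 * (n - 1)).
  move: h1; case: ifP => _ h1; apply: leq_trans h1; first by rewrite leq_add2l.
  by rewrite leq_mul2l leq_add2l bb orbT.
case: ifP => _ h2; last first.
  have : (a ^ k * b) * b' <= (a * n + b) * b' by apply: leq_mul.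
  have : (a * n + b) * b' <= (a * n + b') * b.
    by rewrite !mulnDl [b * b']mulnC leq_add2r leq_mul2l bb orbT.
  move=> h3 h4; have := leq_trans h4 h3.
  by rewrite mulnAC leq_mul2r; case: b bb {h1 h2 h3 h4} => [|b] //; lia.
set B := b * _ * _ in h2; set B' := b' * _ * _; set C := _ * _ * _ in h2; set C' := _ * _ * _.
have B0 : 0 < B by rewrite !muln_gt0; lia.
have f j : (n + b + j) * (b' + j) <= (n + b' + j) * (b + j).
  by have := leq_mul (leqnn n) bb; lia.
have CB : C * B' <= C' * B.
  have := leq_mul (leq_mul (f 0) (f 1)) (f 2); rewrite !addn0 /C /C' /B /B'.
  by move=> h3; apply: leq_trans (leq_trans h3 _); apply: eq_leq; ring.
by rewrite -(leq_pmul2r B0) mulnAC (leq_trans _ CB) // leq_mul2r h2 orbT.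
Qed.

Lemma amaxn_mono k n n' : n <= n' -> amaxn k n <= amaxn k n'.
Proof.
move=> nn; rewrite /amaxn; have : trunc_log 2 (n - 1) <= trunc_log 2 (n' - 1).
  by apply: leq_trunc_log; lia.
by move=> tt; case: (k == 1); last case: (k == 2); apply: leq_div2r; lia.
Qed.

Section Admissible.

Variables (a b n k : nat).
Hypotheses (a0 : 0 < a) (b0 : 0 < b) (k0 : 0 < k) (kn : k <= n) (n1 : 1 < n).
Hypothesis F0k : integral a b n k.

Let nE : n = (n - 1).+1. Proof. by lia. Qed.

Lemma amaxn_holds : a <= amaxn k n.
Proof.
have F0k' := F0k; rewrite /integral nE in F0k'.
have n0 : 0 < n - 1 by lia.
have kn' : k <= (n - 1).+1 by lia.
rewrite /amaxn; case: ifP => [/eqP k1|_]; last case: ifP => [/eqP k2|_].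
- by rewrite leq_divRL // mulnC; apply: (bound_a1 b0 n0 k0 kn' F0k' k1).
- by rewrite leq_divRL // mulnC; apply: (bound_a2 b0 n0 k0 kn' F0k' k2).
rewrite leq_divRL ?muln_gt0 ?k0 // mulnCA mulnA.
by apply: (bound_a b0 n0 k0 kn' F0k').
Qed.

(** The second condition is [shift_bound] with s = 3 when a = 1 and with s = 1 otherwise. *)
Lemma permitn_holds : permitn k n a b.
Proof.
have F0k' := F0k; rewrite /integral nE in F0k'.
have n0 : 0 < n - 1 by lia.
have kn' : k <= (n - 1).+1 by lia.
rewrite /permitn; have -> : (if k == 1 then a + b <= 2 * (n - 1) else k * (a + b) <= 3 * (n - 1)).
  case: ifP => [/eqP k1|_]; first by apply: (bound_ab1 b0 n0 k0 kn' F0k' k1).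
  by apply: (bound_ab b0 n0 k0 kn' F0k').
have le : fc (ap a b n) 0 <= fc (ap a b n) k.
  by apply: dvdn_leq F0k; apply: fc_gt0_le; rewrite ?ap_gt0 ?size_ap.
case: ifP => [/eqP a1|_]; last first.
  have := shift_bound 1 b0 le.
  by rewrite /index_iota /= !big_cons !big_nil !muln1 !muln0 addn0 add0n.
have := shift_bound 3 b0 le; rewrite a1 /index_iota /= !big_cons !big_nil.
by rewrite mul1n; move: (3 ^ k) => K; clear; lia.
Qed.

End Admissible.

(** The elementary symmetric functions, that is, the coefficients [fc] in reverse order. *)
Fixpoint esymn (s : seq nat) (r : nat) : nat :=
  if s is x :: s' then esymn s' r + x * (if r is r'.+1 then esymn s' r' else 0) else (r == 0).

Lemma fc_esymn s k : k <= size s -> fc s k = esymn s (size s - k).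
Proof.
elim: s k => [|x s IHs] [|k] //= ks.
  rewrite addn0 IHs // subn0.
  suff H : forall r, size s < r -> esymn s r = 0 by rewrite (H _ (ltnSn _)) // add0n.
  elim: {IHs ks} s => [|y s IHs] [|r] //= sr; rewrite !IHs //; last exact: ltnW.
  by rewrite muln0.
have [ks'|ks'] := leqP k.+1 (size s); last first.
  have kE : k = size s by lia.
  rewrite fc_over // muln0 add0n IHs // kE !subnn.
  by case: (s) => [|y s'] /=; rewrite ?muln0 ?addn0.
rewrite IHs // IHs // subSS addnC.
by have -> : size s - k = (size s - k.+1).+1 by lia.
Qed.

Lemma nth_mul_1aX p x prev l i : i < size l ->
  nth 0%num (mul_1aX p x prev l) i =
  ((nth 0 l i + x * (if i is i'.+1 then nth 0 l i' else prev)) mod p)%num.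
Proof. by elim: l i prev => [|h l IHl] [|i] prev //= il; rewrite IHl //; case: i il. Qed.

Lemma size_mul_1aX p x prev l : size (mul_1aX p x prev l) = size l.
Proof. by elim: l prev => //= h l IHl prev; rewrite IHl. Qed.

Lemma esym_apP p a m c j : size (esym_ap p a m c j) = j.+1 /\
  forall i, i <= j -> #(nth 0%num (esym_ap p a m c j) i) = esymn (ap #a #c m) i %[mod #p].
Proof.
elim: m c => [|m IHm] c.
  split; first by rewrite /= size_nseq.
  by case=> [|i] ij //=; rewrite nth_nseq if_same.
have [sz IH] := IHm (c + a)%num.
have -> : esym_ap p a m.+1 c j = mul_1aX p c 0 (esym_ap p a m (c + a)%num j) by [].
split; first by rewrite size_mul_1aX.
rewrite apS addnC -to_natD => i ij.
rewrite nth_mul_1aX ?sz // to_nat_mod modn_mod to_natD to_natM.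
case: i ij => [|i] ij; rewrite [esymn (_ :: _) _]/=; first by rewrite -modnDml IH // modnDml.
by rewrite -modnDm IH // -[(#c * _) %% _]modnMmr IH 1?ltnW // modnMmr modnDm.
Qed.

Lemma nth_mul_aX p x prev l i : i < size l ->
  nth 0%num (mul_aX p x prev l) i =
  ((x * nth 0 l i + (if i is i'.+1 then nth 0 l i' else prev)) mod p)%num.
Proof. by elim: l i prev => [|h l IHl] [|i] prev //= il; rewrite IHl //; case: i il. Qed.

Lemma size_mul_aX p x prev l : size (mul_aX p x prev l) = size l.
Proof. by elim: l prev => //= h l IHl prev; rewrite IHl. Qed.

Lemma coef_apP p a m c j : size (coef_ap p a m c j) = j.+1 /\
  forall i, i <= j -> #(nth 0%num (coef_ap p a m c j) i) = fc (ap #a #c m) i %[mod #p].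
Proof.
elim: m c => [|m IHm] c.
  split; first by rewrite /= size_nseq.
  by case=> [|i] ij //=; rewrite nth_nseq if_same.
have [sz IH] := IHm (c + a)%num.
have -> : coef_ap p a m.+1 c j = mul_aX p c 0 (coef_ap p a m (c + a)%num j) by [].
split; first by rewrite size_mul_aX.
rewrite apS addnC -to_natD => i ij.
rewrite nth_mul_aX ?sz // to_nat_mod modn_mod to_natD to_natM.
case: i ij => [|i] ij; rewrite [fc (_ :: _) _]/=.
  by rewrite -modnDml -modnMmr IH // modnMmr modnDml.
by rewrite -modnDm -[(#c * _) %% _]modnMmr IH // IH 1?ltnW // modnMmr modnDm.
Qed.

Lemma nth_size_pred (T : Type) (x0 : T) l j : size l = j.+1 -> nth x0 l j = last x0 l.
Proof. by move=> lj; rewrite -nth_last lj. Qed.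

Lemma prime_witnessP (a b n k p : N) : prime #p -> 0 < #b -> 0 < #k ->
  prime_witness a b n k p -> ~~ integral #a #b #n #k.
Proof.
move=> pp b0 k0; rewrite /prime_witness !(eqb_to_nat, leb_to_nat, ltb_to_nat) to_nat_mod; case: ifP => // /negbT pa.
set c := find_quot _ _ _ _ _; set i := ((c * p - b) / a)%num.
case: ifP => // /negbFE; rewrite to_natD !to_natM => /eqP cE; case: ifP => // /negbT.
rewrite -ltnNge => ip; case: ifP => // /negbT; rewrite -ltnNge => i_n.
set m := ((n - 1 - i) / p + 1)%num.
have mE : #m = (#n - 1 - #i) %/ #p + 1 by rewrite to_natD to_nat_div !to_natB.
have p0 := prime_gt0 pp.
have m1 : #n <= #i + #p * #m.
  by have := ltn_ceil (#n - 1 - #i) p0; rewrite mE; lia.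
have m2 : #i + #p * #m < #n + #p.
  by have := leq_trunc_div (#n - 1 - #i) #p; rewrite mE; lia.
case: ifP => // /negbT; rewrite -leqNgt => km H.
apply/negP => F0k; have := filter_ap (m := #m) pp pa cE ip m1 m2.
move/(dvdn_coef pp)/(_ _ F0k); rewrite size_ap k0 km => /(_ isT).
rewrite fc_esymn ?size_ap //; move: H; case: eqP => [<-|_].
  rewrite subnn => _; have := fc_esymn (leqnn (size (ap #a #c #m))).
  by rewrite fc_size subnn => <-; rewrite dvdn1 => /eqP p1; rewrite p1 in pp.
have [sz /(_ _ (leqnn _))] := esym_apP p a #m c #(m - k)%num.
rewrite (nth_size_pred _ sz) to_natB => E nz.
by move: nz; rewrite to_nat_mod /dvdn -E => /negPf->.
Qed.

Lemma modulus_witnessP (a b n k M : N) : 0 < #b ->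
  modulus_witness a b n k M -> ~~ integral #a #b #n #k.
Proof.
move=> b0; rewrite /modulus_witness !(eqb_to_nat, to_nat_mod).
have [sz H] := coef_apP M a #n b #k; set l := coef_ap _ _ _ _ _ in sz H *.
have := H 0 (leq0n _); have := H #k (leqnn _).
rewrite nth0 (nth_size_pred _ sz).
case: ifP => // /eqP h0 hk h0' nz; apply/negP => F0k.
have M0 : #M %| fc (ap #a #b #n) 0 by rewrite /dvdn -h0' h0.
have := dvdn_trans M0 F0k; rewrite /dvdn -hk; exact/negP.
Qed.

Lemma candidates_sub q l : {subset candidates q l <= l}.
Proof.
elim: l => // p [|p' l'] IHl //; rewrite [candidates _ _]/=.
case: ifP => _; first by move=> x /IHl xl; rewrite inE xl orbT.
by move=> x; apply: (@mem_take 4 _ [:: p, p' & l']).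
Qed.

(** Meant for n > 1, where only the exception with n = 3 remains. *)
Definition solved (k n : nat) := forall a b, 0 < a -> 0 < b -> k <= n ->
  integral a b n k -> [&& a == 1, b == 1, n == 3 & k == 2].

Lemma tuple_okP (a b n k : N) cs : all (fun p => prime #p) cs -> 0 < #b -> 0 < #k ->
  tuple_ok a b n k cs -> integral #a #b #n #k ->
  [&& #a == 1, #b == 1, #n == 3 & #k == 2].
Proof.
move=> cp b0 k0; rewrite /tuple_ok; case: ifP => [/any_ofP[p /(allP cp) pp pw] _ F|_].
  by have /negP := prime_witnessP pp b0 k0 pw.
case: ifP => [|_ /any_ofP[M _ Mw] F]; last by have /negP := modulus_witnessP b0 Mw.
by rewrite /exceptional !eqb_to_nat; do 3 case: ifP => // ->.
Qed.

Lemma all_bP (k t3 n a ak : N) cs fuel b : #t3 = 3 ^ #k -> #ak = #a ^ #k ->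
  all (fun p => prime #p) cs -> 0 < #k -> 0 < #b ->
  all_b k t3 n a ak cs fuel b -> forall b', #b <= b' -> b' < #b + fuel ->
  permitn #k #n #a b' -> integral #a b' #n #k ->
  [&& #a == 1, b' == 1, #n == 3 & #k == 2].
Proof.
move=> t3E akE cp k0; elim: fuel b => [|fuel IHf] b b0 /=; first by lia.
rewrite (permitE _ _ t3E akE); case: ifP => [_|np _ b' bb _ pm]; last first.
  by move: np; rewrite (permitn_antib _ pm) ?b0.
case: ifP => // tk H b' bb bf pm F; have [E|ne] := eqVneq #b b'.
  by rewrite -E in F *; apply: tuple_okP tk F.
by apply: (IHf (b + 1)%num) pm F; rewrite ?to_natD //=; lia.
Qed.

Lemma check_nP sm (k t3 n : N) : #t3 = 3 ^ #k -> all (fun p => prime #p) sm ->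
  0 < #k -> 1 < #n -> check_n sm k t3 n -> solved #k #n.
Proof.
move=> t3E sp k0 n1 /all_fromP H a b a0 b0 kn F.
have aE : a = #(N.of_nat a) by rewrite Nat2N.id.
have pm := permitn_holds a0 b0 k0 kn n1 F.
(* The fuel 2 n of [check_n] therefore reaches every permitted b. *)
have ab : b < 1 + 2 * #n.
  move: pm; rewrite /permitn; case: ifP => //; case: ifP => [_|/negbT k1]; first by lia.
  have k2 : 2 <= #k by lia.
  have : 2 * (a + b) <= #k * (a + b) by rewrite leq_mul2r k2 orbT.
  by move=> *; lia.
have am := amaxn_holds a0 b0 k0 kn n1 F.
have := H (N.of_nat a); rewrite -aE => /(_ a0); rewrite amaxE add1n ltnS => /(_ am).
move=> Hb.
have akE : #(N.of_nat a ^ k)%num = #(N.of_nat a) ^ #k by rewrite to_natX.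
have cp : all (fun p => prime #p) (candidates (n / k) sm).
  by apply/allP => p /candidates_sub /(allP sp).
have b1 : 0 < #1%num by [].
by have := all_bP t3E akE cp k0 b1 Hb (b' := b) b0; rewrite to_natM -aE; apply.
Qed.

Lemma check_rangeP sm (k t3 lo hi : N) : #t3 = 3 ^ #k -> all (fun p => prime #p) sm ->
  0 < #k -> 1 < #lo -> check_range sm k t3 lo hi ->
  forall n, #lo <= n < #hi -> solved #k n.
Proof.
move=> t3E sp k0 lo1 /all_fromP H n /andP[ln nh].
rewrite -(Nat2N.id n); apply: (check_nP t3E sp k0); first by rewrite Nat2N.id; lia.
by apply: H; rewrite Nat2N.id // to_natB subnKC //; lia.
Qed.

Lemma no_permitP (k t3 m : N) : #t3 = 3 ^ #k -> 0 < #k -> no_permit k t3 m ->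
  forall n, 1 < n -> n <= #m -> solved #k n.
Proof.
move=> t3E k0 /all_fromP H n n1 nm a b a0 b0 kn F.
have aE : a = #(N.of_nat a) by rewrite Nat2N.id.
have am := leq_trans (amaxn_holds a0 b0 k0 kn n1 F) (amaxn_mono #k nm).
have := H (N.of_nat a); rewrite -aE => /(_ a0); rewrite amaxE add1n ltnS => /(_ am).
have akE : #(N.of_nat a ^ k)%num = #(N.of_nat a) ^ #k by rewrite to_natX.
rewrite (permitE _ _ t3E akE) -aE => /negP[].
apply: (@permitn_antib _ _ _ b); first by rewrite b0.
exact: permitn_monon nm (permitn_holds a0 b0 k0 kn n1 F).
Qed.

Lemma good_primeP (k t3 p : N) : #t3 = 3 ^ #k -> 0 < #k -> prime #p -> good_prime k t3 p ->
  forall n, 1 < n -> #k * #p <= n < (#k).+1 * #p -> solved #k n.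
Proof.
move=> t3E k0 pp; rewrite /good_prime !(ltb_to_nat, to_natD, to_natM, to_natB).
set nm := ((k + 1) * p - 1)%num; case: ifP => // kp /all_fromP H n n1 /andP[kpn nkp].
move=> a b a0 b0 kn F.
have nmE : #nm = (#k).+1 * #p - 1 by rewrite to_natB to_natM to_natD addn1.
have aE : a = #(N.of_nat a) by rewrite Nat2N.id.
have nnm : n <= #nm by rewrite nmE; lia.
have am := leq_trans (amaxn_holds a0 b0 k0 kn n1 F) (amaxn_mono #k nnm).
have pm := permitn_monon nnm (permitn_holds a0 b0 k0 kn n1 F).
have := H (N.of_nat a); rewrite -aE => /(_ a0); rewrite amaxE add1n ltnS => /(_ am).
have akE : #(N.of_nat a ^ k)%num = #(N.of_nat a) ^ #k by rewrite to_natX.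
rewrite !(permitE _ _ t3E akE) -aE (permitn_antib _ pm) ?b0 //.
rewrite ltb_to_nat to_natM to_natD -aE. case: ifP => ap np; last by [].
case/negP: np.
rewrite to_natD to_nat_div to_natB !to_natM to_natD -aE; apply: permitn_antib pm.
rewrite addn1 /= ltnNge; apply/negP => bs.
have := simple_criterion (n := n) (k := #k) (p := #p) a0 b0 k0 pp kpn nkp.
rewrite -[(#k).+1]addn1 => /(_ kp) Hs.
have h1 : a < #p by apply: leq_trans ap; rewrite ltnS leq_pmulr //; lia.
have h2 : 2 * b + a * (#k + 2) * #p <= #p * #p.
  have : a * (#k + 2) * #p <= #p * #p by rewrite leq_mul2r ltnW ?orbT.
  move: (a * (#k + 2) * #p) bs => u bs up.
  by have := leq_trunc_div (#p * #p - u) 2; lia.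
by have /negP := Hs h1 h2.
Qed.

Lemma walkP (N0 : N) sm (k t3 : N) ps cur : #t3 = 3 ^ #k ->
  all (fun p => prime #p) sm -> all (fun p => prime #p) ps -> 0 < #k -> 1 < #cur ->
  walk N0 sm k t3 ps cur -> forall n, #cur <= n < #N0 -> solved #k n.
Proof.
move=> t3E sp pps k0; elim: ps cur pps => [|p ps IHp] cur /= pps c1.
  by rewrite leb_to_nat; case: ifP => // h _ n /andP[h1 h2]; lia.
move/andP: pps => [pp pps]; rewrite leb_to_nat; case: ifP => [h _ n /andP[h1 h2]|_]; first by lia.
case: ifP => [_|_]; first exact: IHp.
case: ifP => [_|_]; first exact: IHp.
set c2 := N.max cur (k * p); case: ifP => // r1; case: ifP => // r2 w n /andP[cn nN].
have kp1 : #((k + 1) * p)%num = (#k).+1 * #p by rewrite to_natM to_natD addn1.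
have c2E : #c2 = maxn #cur (#k * #p) by rewrite -to_natM /c2; lia.
have p1 := prime_gt1 pp.
have c2_1 : 1 < #c2 by rewrite c2E; lia.
have kp1_1 : 1 < #((k + 1) * p)%num by rewrite kp1; nia.
have [n2|n2] := ltnP n #c2.
  by apply: (check_rangeP t3E sp k0 c1 r1); rewrite cn.
have [n3|n3] := ltnP n #((k + 1) * p)%num; last first.
  by apply: (IHp _ pps kp1_1 w); rewrite n3.
case: ifP r2 => [gp _|_ r2]; last by apply: (check_rangeP t3E sp k0 c2_1 r2); rewrite n2.
apply: (good_primeP t3E k0 pp gp); first by lia.
by rewrite -kp1 n3 andbT; move: n2; rewrite c2E geq_max => /andP[].
Qed.

Lemma check_kP N0 chain sm (k n0 : N) :
  all (fun p => prime #p) sm -> all (fun p => prime #p) chain -> 0 < #k ->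
  check_k N0 chain sm k n0 -> forall n, 1 < n < #N0 -> solved #k n.
Proof.
move=> sp cp k0; rewrite /check_k; have t3E : #(3 ^ k)%num = 3 ^ #k by rewrite to_natX.
case: ifP => // h w n /andP[n1 nN].
have n01 : 1 < #n0.
  by move: h; rewrite eqb_to_nat; case: ifP => [/eqP->//|_]; rewrite ltb_to_nat; case: ifP.
have [nn|nn] := leqP #n0 n; first by apply: (walkP t3E sp cp k0 n01 w); rewrite nn.
move: h; rewrite eqb_to_nat; case: ifP => [/eqP n02|_]; first by move: nn; rewrite n02 /=; lia.
case: ifP => // _ np; apply: (no_permitP t3E k0 np) => //; rewrite to_natB -[#1]/1; lia.
Qed.

(** * Primality by trial division over the classes 1 and 5 modulo 6 *)

Lemma trialP p fuel d : #d %% 6 = 5 -> trial p fuel d ->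
  forall e, #d <= e -> e ^ 2 <= #p -> (e %% 6 = 1 \/ e %% 6 = 5) -> ~~ (e %| #p).
Proof.
elim: fuel d => // fuel IHf d d6 /=; rewrite ltb_to_nat to_natM.
case: ifP => [h _ e de ep|_].
  by have := leq_mul de de; rewrite mulnn; lia.
rewrite eqb_to_nat to_nat_mod; case: ifP => // /negbT h1; rewrite eqb_to_nat to_nat_mod to_natD; case: ifP => // /negbT h2 t.
have d6' : #(d + 6) %% 6 = 5 by rewrite to_natD /= modnDr.
move=> e de ep e6; have [h|h] := leqP #(d + 6)%num e; first exact: IHf d6' t e h ep e6.
have [->|->] : e = #d \/ e = #d + 2; last 2 first.
- exact: h1.
- exact: h2.
move: h; rewrite to_natD => h; have {}h : e < #d + 6 by exact: h.
move: (#d) d6 de h => x d6 de h; clear - d6 de h e6; lia.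
Qed.

Lemma mod6_coprime q : ~~ (2 %| q) -> ~~ (3 %| q) -> q %% 6 = 1 \/ q %% 6 = 5.
Proof.
rewrite /dvdn -(@modn_dvdm 6 q 2) // -(@modn_dvdm 6 q 3) //.
have := ltn_pmod q (isT : 0 < 6).
by case: (q %% 6) => [|[|[|[|[|[|]]]]]] // _ _ _; [left | right].
Qed.

Lemma is_primeP p : is_prime p -> prime #p.
Proof.
rewrite /is_prime ltb_to_nat; case: ifP => [_|/negbT p5].
  by rewrite !eqb_to_nat; case: ifP => [/eqP->//|_ /eqP->].
rewrite -leqNgt -[#5]/5 in p5.
rewrite eqb_to_nat to_nat_mod; case: ifP => // /negbT p2; rewrite eqb_to_nat to_nat_mod; case: ifP => // /negbT p3 t.
apply: ltn_pdiv2_prime; first by lia.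
rewrite ltnNge; apply/negP => le; have pd : prime (pdiv #p) by apply: pdiv_prime; lia.
have dv := pdiv_dvd #p.
have n2 : ~~ (2 %| pdiv #p) by apply: contra p2 => /dvdn_trans/(_ dv).
have n3 : ~~ (3 %| pdiv #p) by apply: contra p3 => /dvdn_trans/(_ dv).
have e6 := mod6_coprime n2 n3.
have e5 : 5 <= pdiv #p by have := prime_gt1 pd; lia.
by have /negP := trialP (p := p) (d := 5) erefl t e5 le e6.
Qed.

(** The intervals [k p, (k + 1) p) of successive primes leave no gap when their ratio is at most (k
    + 1) / k. The first 80 entries are all the primes up to 409; the last ones lie slightly above
    2^27 / (k + 1) for k = ..., 2, 1, where the walk for k ends. *)
Definition chain : seq N := [::
  2; 3; 5; 7; 11; 13; 17; 19; 23; 29; 31; 37; 41; 43; 47; 53; 59; 61; 67; 71; 73; 79; 83; 89;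
  97; 101; 103; 107; 109; 113; 127; 131; 137; 139; 149; 151; 157; 163; 167; 173; 179; 181; 191;
  193; 197; 199; 211; 223; 227; 229; 233; 239; 241; 251; 257; 263; 269; 271; 277; 281; 283;
  293; 307; 311; 313; 317; 331; 337; 347; 349; 353; 359; 367; 373; 379; 383; 389; 397; 401;
  409; 421; 439; 457; 467; 487; 503; 523; 541; 563; 577; 601; 619; 643; 661; 683; 709; 733;
  761; 787; 811; 839; 863; 887; 919; 953; 983; 1019; 1051; 1091; 1129; 1171; 1213; 1259; 1307;
  1327; 1373; 1423; 1471; 1523; 1579; 1637; 1697; 1759; 1823; 1879; 1933; 1999; 2069; 2141;
  2213; 2287; 2357; 2441; 2521; 2593; 2677; 2767; 2861; 2957; 3049; 3137; 3229; 3331; 3433;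
  3547; 3659; 3779; 3889; 4013; 4139; 4273; 4409; 4549; 4691; 4831; 4987; 5147; 5309; 5479;
  5653; 5827; 6011; 6203; 6397; 6599; 6803; 7013; 7229; 7451; 7681; 7919; 8161; 8389; 8647;
  8893; 9161; 9439; 9733; 10009; 10303; 10613; 10909; 11239; 11579; 11927; 12281; 12653; 13033;
  13421; 13807; 14207; 14621; 15031; 15473; 15923; 16381; 16843; 17333; 17839; 18353; 18869;
  19403; 19949; 20509; 21089; 21683; 22291; 22921; 23567; 24239; 24923; 25633; 26357; 27077;
  27827; 28597; 29389; 30203; 31039; 31891; 32771; 33679; 34613; 35573; 36559; 37573; 38569;
  39607; 40639; 41737; 42863; 44021; 45197; 46411; 47659; 48947; 50263; 51613; 52967; 54347;
  55763; 57223; 58727; 60271; 61843; 63467; 65129; 66841; 68597; 70393; 72229; 74101; 76001;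
  77933; 79907; 81953; 84053; 86201; 88411; 90677; 93001; 95383; 97813; 100313; 102881; 105449;
  108079; 110777; 113539; 116371; 119267; 122231; 125269; 128399; 131591; 134873; 138241;
  141697; 145219; 148747; 152363; 156071; 159871; 163753; 167729; 171811; 175993; 180281;
  184669; 189169; 193771; 198491; 203323; 208147; 213097; 218149; 223339; 228647; 234089;
  239641; 245339; 251179; 257141; 263257; 269519; 275929; 282493; 289213; 295937; 302801;
  309823; 317021; 324391; 331921; 339637; 347533; 355609; 363871; 372313; 380971; 389819;
  398863; 408137; 417383; 426863; 436549; 446461; 456607; 466957; 477557; 488407; 499507;
  510847; 522449; 534311; 546391; 558793; 571477; 584167; 597137; 610391; 623947; 637787;
  651943; 666427; 681229; 696361; 711829; 727633; 743791; 760301; 777191; 794449; 812101;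
  829733; 847741; 866161; 884987; 904219; 923869; 943951; 964463; 985417; 1006799; 1028683;
  1051027; 1073869; 1097209; 1121051; 1145411; 1169767; 1194631; 1220041; 1245973; 1272461;
  1299533; 1327181; 1355401; 1384237; 1413679; 1443727; 1474441; 1505797; 1537819; 1570531;
  1603919; 1637299; 1671379; 1706191; 1741723; 1778003; 1815043; 1852843; 1891433; 1930823;
  1971029; 2012083; 2053979; 2096761; 2140441; 2185033; 2230549; 2277013; 2323463; 2370847;
  2419229; 2468591; 2518961; 2570363; 2622799; 2676313; 2730929; 2786659; 2844713; 2905237;
  2968391; 3034351; 3103313; 3175463; 3251069; 3330323; 3413573; 3501097; 3593203; 3690307;
  3792809; 3901153; 4015883; 4137571; 4266859; 4404469; 4551233; 4708159; 4876307; 5056873;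
  5251361; 5461411; 5688941; 5936269; 6206089; 6501611; 6826657; 7185943; 7585139; 8031323;
  8533267; 9102139; 9752279; 10502441; 11377627; 12411953; 13653137; 15170131; 17066383;
  19504409; 22755137; 27306163; 34132699; 45510253; 68265377]%num.

(* For n below the k-th entry (from k = 1), no (a, b) is admissible; the entry is
   capped at 2 ^ 27. *)
Definition start : seq N := [::
  2; 3; 4; 6; 10; 15; 22; 33; 48; 69; 101; 146; 211; 305; 440; 635; 917; 1323; 1909; 2754;
  3973; 5730; 8265; 11921; 17193; 24798; 35765; 51583; 74396; 107298; 154751; 223190; 321896;
  464255; 669572; 965691; 1392768; 2008720; 2897076; 4178307; 6026162; 8691230; 12534923;
  18078488; 26073693; 37604773; 54235468; 78221082; 112814322; 134217728; 134217728; 134217728;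
  134217728; 134217728; 134217728; 134217728; 134217728; 134217728; 134217728; 134217728;
  134217728]%num.

Definition small_primes := rev (take 85 chain).

Lemma chain_prime : all is_prime chain.
Proof. by vm_compute. Qed.

Definition check (k : nat) := check_k (2 ^ 27) chain small_primes (N.of_nat k) (nth 0%num start k.-1).

Lemma check_1_12 : all check (iota 1 12).
Proof. by vm_compute. Qed.

Lemma check_13_61 : all check (iota 13 49).
Proof. by vm_compute. Qed.

Lemma solved_small k n : 0 < k <= 61 -> 1 < n < 2 ^ 27 -> solved k n.
Proof.
move=> /andP[k0 k61] n27.
have ck : check k.
  have [k13|k13] := ltnP k 13; first by apply: (allP check_1_12); rewrite mem_iota k0.
  by apply: (allP check_13_61); rewrite mem_iota k13.
have cp : all (fun p => prime #p) chain by apply: sub_all chain_prime => p /is_primeP.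
have sp : all (fun p => prime #p) small_primes.
  by apply/allP => p; rewrite mem_rev => /mem_take /(allP cp).
rewrite -(Nat2N.id k); apply: (check_kP sp cp _ ck); first by rewrite Nat2N.id.
have -> : #(2 ^ 27)%num = 2 ^ 27 := to_natX 2 27.
exact: n27.
Qed.

(** * Joining the ranges of n *)

Import GRing.Theory Num.Theory.
Local Open Scope ring_scope.

Lemma Sab_intE a b n k : (0 < b)%N -> (Sab a b n k \is a Num.int) = integral a b n k.
Proof.
move=> b0; apply/idP/idP => [|/dvdnP[q Fq]]; first exact: Sab_int.
have := Sab_fc a n k b0; rewrite Fq natrM => /mulIf->; first exact: intr_nat.
by rewrite pnatr_eq0 -lt0n fc_gt0 // ap_gt0.
Qed.

Theorem theorem1p1 (a b n k : nat)
    (a_gt0 : (0 < a)%N) (b_gt0 : (0 < b)%N) (n_gt0 : (0 < n)%N)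
    (k_gt0 : (1 <= k)%N) (k_le_n : (k <= n)%N) :
  Sab a b n k \is a Num.int <->
    (b = 1%N /\ n = 1%N /\ k = 1%N) \/
    (a = 1%N /\ b = 1%N /\ n = 3%N /\ k = 2%N).
Proof.
rewrite Sab_intE //; split=> [F|]; last first.
  by case=> [[-> [-> ->]]|[-> [-> [-> ->]]]]; rewrite /integral //= muln0.
have [n1|n1] := leqP n 1.
  have nE : n = 1%N by lia.
  have kE : k = 1%N by lia.
  left; move: F; rewrite nE kE /integral /= !muln0 !muln1 !add0n !addn0.
  by rewrite dvdn1 => /eqP.
right; have n27 := large_n a_gt0 b_gt0 k_gt0 k_le_n n1 F.
(* As n < 2^27, the logarithm is at most 26, so 20 k <= 3 (15 . 26 + 22) = 1236. *)
have k61 : (k <= 61)%N.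
  have := a_le a_gt0 b_gt0 k_gt0 k_le_n n1 F.
  have : (trunc_log 2 n.-1 < 27)%N.
    rewrite -(ltn_exp2l _ _ (isT : 1 < 2)%N); apply: leq_ltn_trans n27.
    by apply: leq_trans (trunc_logP _ _) _ => //; lia.
  have : (k <= a * k)%N by rewrite leq_pmull.
  lia.
have k061 : (0 < k <= 61)%N by rewrite k_gt0.
have n127 : (1 < n < 2 ^ 27)%N by rewrite n1.
by have /and4P[/eqP-> /eqP-> /eqP-> /eqP->] := solved_small k061 n127 a_gt0 b_gt0 k_le_n F.
Qed.
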